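(* Let $\mathscr T=(V,\mathcal E)$ be a rooted directed tree with finite branching index $k_{\mathscr T}$. Let $S_\lambda\in B(l^2(V))$ be a left-invertible weighted shift on $\mathscr T$ and let $S_{\lambda'}$ be the Cauchy dual of $S_\lambda$. Set $E:=\ker S_\lambda^*$. Then there exist a $z$-invariant reproducing kernel Hilbert space $\mathscr H$ of $E$-valued holomorphic functions defined on the disc $\mathbb D_{r_\lambda}$ and a unitary mapping $U:l^2(V)\to\mathscr H$ such that $\mathscr M_zU=US_\lambda$, where $\mathscr M_z$ denotes the operator of multiplication by $z$ on $\mathscr H$ and $r_\lambda$ is the radius of convergence for $S_\lambda$. Moreover, $r_\lambda\, r(S_{\lambda'})\ge 1$, where $r(S_{\lambda'})$ is the spectral radius of $S_{\lambda'}$. Further, $U$ maps $E$ onto the subspace $\mathscr E$ of $E$-valued constant functions in $\mathscr H$ such that $Ug=g$ for every $g\in E$. Furthermore: (i) The reproducing kernel $\kappa_{\mathscr H}:\mathbb D_{r_\lambda}\times\mathbb D_{r_\lambda}\to B(E)$ associated with $\mathscr H$ satisfies $\kappa_{\mathscr H}(\cdot,w)g\in\mathscr H$ and $\langle Uf,\kappa_{\mathscr H}(\cdot,w)g\rangle_{\mathscr H}=\langle (Uf)(w),g\rangle_E$ for every $w\in\mathbb D_{r_\lambda}$, $f\in l^2(V)$ and $g\in E$. (ii) $\kappa_{\mathscr H}$ is given by $$\kappa_{\mathscr H}(z,w)=I_E+\sum_{\substack{j,k\ge 1\\ |j-k|\le k_{\mathscr T}}}C_{j,k}\,z^j\overline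 w^k\qquad(z,w\in\mathbb D_{r_\lambda}),$$ where $I_E$ denotes the identity operator on $E$, and $C_{j,k}$ are the bounded linear operators on $E$ given by $C_{j,k}=P_ES_{\lambda'}^{*j}S_{\lambda'}^k|_E$ $(j,k=1,2,\dots)$, with $P_E$ the orthogonal projection of $l^2(V)$ onto $E$. (iii) The $E$-valued polynomials in $z$ are dense in $\mathscr H$. In fact, $\mathscr H=\bigvee\{z^nf: f\in\mathscr E,\ n\ge 0\}$. (iv) $\mathscr H$ admits an orthonormal basis consisting of polynomials in $z$ with at most $k_{\mathscr T}+1$ non-zero coefficients.
   Context: Directed trees. A directed graph is a pair $\mathscr T=(V,\mathcal E)$ with $V$ non-empty and $\mathcal E\subseteq V\times V\setminus\{(v,v):v\in V\}$. A circuit is a finite sequence of distinct vertices $v_1,\dots,v_n$, $n\ge2$, with $(v_i,v_{i+1})\in\mathcal E$ for $1\le i\le n-1$ and $(v_n,v_1)\in\mathcal E$. The graph is connected if any two distinct vertices are joined by a finite sequence of vertices in which, for consecutive vertices $a,b$, $(a,b)\in\mathcal E$ or $(b,a)\in\mathcal E$. A root is a vertex $v$ such that $(u,v)\in\mathcal E$ for no $u$; $V^\circ$ is the set of non-root vertices. A directed tree is a connected directed graph without circuits in which every $v\in V^\circ$ has a unique $u$ (the parent $\mathsf{par}(v)$) with $(u,v)\in\mathcal E$. A directed tree has at most one root; it is rooted if it has one, denoted $\mathsf{root}$. For $W\subseteq V$, $\mathsf{Chi}(W)=\bigcup_{u\in W}\{v:(u,v)\in\mathcal E\}$, $\mathsf{Chi}^{\langle0\rangle}(W)=W$,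 $\mathsf{Chi}^{\langle n\rangle}(W)=\mathsf{Chi}(\mathsf{Chi}^{\langle n-1\rangle}(W))$, and $\mathsf{Chi}^{\langle n\rangle}(v)=\mathsf{Chi}^{\langle n\rangle}(\{v\})$; $\mathsf{par}^{\langle n\rangle}$ is the $n$-fold iterate of $\mathsf{par}$. By convention $\mathsf{Chi}^{\langle j\rangle}(\mathsf{root})=\emptyset$ for $j<0$. Leafless means every vertex has at least one child. All directed trees are assumed countably infinite and leafless. Weighted shifts. $l^2(V)$ has orthonormal basis $e_u=\chi_{\{u\}}$, $u\in V$. Given weights $\{\lambda_v\}_{v\in V^\circ}$ (always assumed positive), the weighted shift $S_\lambda$ is $(S_\lambda f)(v)=\lambda_vf(\mathsf{par}(v))$ for $v\in V^\circ$ and $(S_\lambda f)(\mathsf{root})=0$; it is assumed to be bounded on $l^2(V)$. $B(\mathcal H)$ denotes the bounded operators on $\mathcal H$. $T\in B(\mathcal H)$ is left-invertible if $ST=I$ for some $S\in B(\mathcal H)$; its Cauchy dual is $T'=T(T^*T)^{-1}$. The Cauchy dual of a left-invertible $S_\lambda$, denoted $S_{\lambda'}$, is the weighted shift on $\mathscr T$ with weights $\lambda'_v=\lambda_v/\|S_\lambda e_{\mathsf{par}(v)}\|^2$, $v\in V^\circ$. Branching index. In a rooted directed tree, $V=\bigsqcup_{n\ge0}\mathsf{Chi}^{\langle n\rangle}(\mathsf{root})$; $n_u$ is the unique integer with $u\in\mathsf{Chi}^{\langle n_u\rangle}(\mathsf{root})$. Let $V_\prec=\{u\in V:\mathrm{card}(\mathsf{Chi}(u))\ge2\}$.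 The branching index is $k_{\mathscr T}=1+\sup\{n_w:w\in V_\prec\}$ if $V_\prec\ne\emptyset$, and $k_{\mathscr T}=0$ if $V_\prec=\emptyset$. Radius of convergence. For an integer $n$ let $W_n=\bigcup_{j=n}^{k_{\mathscr T}+n}\mathsf{Chi}^{\langle j\rangle}(\mathsf{root})$. The radius of convergence for $S_\lambda$ is the non-negative number $$r_\lambda=\liminf_{n\to\infty}\Big(\sum_{v\in W_n}\big(\lambda'_v\lambda'_{\mathsf{par}(v)}\cdots\lambda'_{\mathsf{par}^{\langle n-1\rangle}(v)}\big)^2\Big)^{-\frac1{2n}}.$$ Other notation. $\mathbb D_r=\{z\in\mathbb C:|z|<r\}$; $\bigvee$ denotes closed linear span. $z$-invariant means that $zh\in\mathscr H$ whenever $h\in\mathscr H$. Polynomials in $z$ have coefficients in $E$.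
   Formalization: It is additionally assumed that the sums over W_n (n ≥ 1) defining r_λ are finite (equivalently, every vertex has finitely many children); otherwise r_λ = 0, the disc is empty and the claim fails. *)

(* Defs.v *)
From HB Require Import structures.
From mathcomp Require Import all_boot all_order all_algebra finmap.
From mathcomp Require Import complex.
From mathcomp Require Import boolp classical_sets functions cardinality fsbigop.
From mathcomp Require Import reals ereal topology normedtype sequences esum.
From mathcomp Require Import derive exp ring lra.

Set Implicit Arguments.
Unset Strict Implicit.
Unset Printing Implicit Defensive.

Import Order.TTheory GRing.Theory Num.Theory.
Import numFieldNormedType.Exports.

Local Open Scope classical_set_scope.
Local Open Scope ring_scope.

(* Norms of complex normed spaces are valued in R[i]; rnorm is the same norm as
   a real number. *)
Definition rnorm {R : rcfType} {V : normedZmodType R[i]} (x : V) : R :=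
  complex.Re `|x|.

Section DotNorm.
Variables (C : numClosedFieldType) (U : lmodType C) (f : {dot U for Num.conj}).

Lemma dot_CauchySchwarz u v : `|f u v| <= sqrtC (f u u) * sqrtC (f v v).
Proof.
have [->|v0] := eqVneq v 0.
  by rewrite !linear0r normr0 sqrtC0 mulr0.
have fv : 0 < f v v by rewrite dnorm_gt0.
have key : `|f u v| ^+ 2 <= f u u * f v v.
  have := dnorm_ge0 f (u - (f u v / f v v) *: v).
  rewrite dnormB dnormZ linearZr_LR /=.
  set a := f u v; set b := f v v in fv *.
  have bR : b^* = b by apply/CrealP; exact: gtr0_real.
  have bI : (b^-1)^* = b^-1 by apply/CrealP; rewrite rpredV; exact: gtr0_real.
  have -> : `|a / b| ^+ 2 * b = `|a| ^+ 2 / b.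
    rewrite normrM normrV ?unitfE ?gt_eqF// (gtr0_norm fv) exprMn -mulrA.
    by rewrite (expr2 b^-1) divfK ?gt_eqF.
  have -> : (a / b)^* * a = `|a| ^+ 2 / b.
    by rewrite rmorphM /= bI normCK mulrAC [a * _]mulrC.
  have -> : (`|a| ^+ 2 / b)^* = `|a| ^+ 2 / b.
    by apply/CrealP; rewrite rpredM ?rpredV ?rpredX ?normr_real ?gtr0_real.
  rewrite opprD addrACA addrN addr0 subr_ge0.
  by rewrite ler_pdivrMr.
rewrite -(@ler_pXn2r _ 2)// ?nnegrE ?mulr_ge0 ?sqrtC_ge0 ?dnorm_ge0//.
by rewrite exprMn !sqrtCK.
Qed.

Lemma dot_triangle u v :
  sqrtC (f (u + v) (u + v)) <= sqrtC (f u u) + sqrtC (f v v).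
Proof.
rewrite -(@ler_pXn2r _ 2)// ?nnegrE ?addr_ge0 ?sqrtC_ge0 ?dnorm_ge0//.
rewrite sqrrD !sqrtCK dnormD addrAC lerD2r lerD2l.
have -> : f u v + (f u v)^* = 'Re (f u v) *+ 2.
  by rewrite ReE -mulr_natr -mulrA mulVf ?mulr1// pnatr_eq0.
rewrite lerMn2r/=.
apply: le_trans (dot_CauchySchwarz u v).
exact: (leif_Re_Creal (f u v)).1.
Qed.

End DotNorm.

(* {dot H for conj} is linear in its first argument. *)
HB.mixin Record CompleteNormedModule_isHilbert (R : realType) H
    & CompleteNormedModule R[i] H := {
  inner : {dot H for Num.conj};
  inner_norm : forall x : H, inner x x = `|x| ^+ 2
}.

#[short(type="hilbertType")]
HB.structure Definition Hilbert (R : realType) :=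
  {H of CompleteNormedModule R[i] H & CompleteNormedModule_isHilbert R H}.

Section AbsSum.
Variables (R : realType) (I : choiceType).

Definition rsummable (u : I -> R) := (\esum_(i in [set: I]) `|u i|%:E < +oo)%E.

(* Unordered sums of absolutely summable families: esum is only meaningful for
   nonnegative terms. *)
Definition rsum (u : I -> R) : R :=
  fine (\esum_(i in [set: I]) (Num.max (u i) 0)%:E) -
  fine (\esum_(i in [set: I]) (Num.max (- u i) 0)%:E).

Definition csum (u : I -> R[i]) : R[i] :=
  (rsum (fun i => complex.Re (u i)) +i* rsum (fun i => complex.Im (u i)))%C.

Lemma rsummable_le (u v : I -> R) :
  (forall i, `|u i| <= `|v i|) -> rsummable v -> rsummable u.
Proof. by move=> uv; apply: le_lt_trans; apply: le_esum => i _; rewrite lee_fin. Qed.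

Lemma rsummableD (u v : I -> R) :
  rsummable u -> rsummable v -> rsummable (fun i => u i + v i).
Proof.
move=> su sv; apply: le_lt_trans (lte_add_pinfty su sv).
by rewrite -esumD//; apply: le_esum => i _; rewrite -EFinD lee_fin ler_normD.
Qed.

Lemma rsummableZ (a : R) (u : I -> R) :
  rsummable u -> rsummable (fun i => a * u i).
Proof.
move=> su; have n1 n : rsummable (fun i => n%:R * u i).
  elim: n => [|n IH].
    by rewrite /rsummable esum1 ?ltry// => i _; rewrite mul0r normr0.
  by under eq_fun do rewrite mulrSr mulrDl mul1r; exact: rsummableD.
apply: rsummable_le (n1 (Num.truncn `|a|).+1) => i.
rewrite !normrM ler_wpM2r// normr_nat ltW//.
by rewrite truncnS_gt.
Qed.

Lemma rsum_pos_fin (u : I -> R) : rsummable u ->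
  (\esum_(i in [set: I]) (Num.max (u i) 0)%:E)%E \is a fin_num.
Proof.
move=> su; rewrite ge0_fin_numE; last first.
  by apply: esum_ge0 => i _; rewrite lee_fin le_max lexx orbT.
apply: le_lt_trans su; apply: le_esum => i _.
by rewrite lee_fin ge_max ler_norm normr_ge0.
Qed.

Lemma rsum_split (u p q : I -> R) :
  (forall i, 0 <= p i) -> (forall i, 0 <= q i) ->
  (forall i, u i = p i - q i) -> rsummable p -> rsummable q ->
  rsum u = fine (\esum_(i in [set: I]) (p i)%:E)
           - fine (\esum_(i in [set: I]) (q i)%:E).
Proof.
move=> p0 q0 upq sp sq.
have su : rsummable u.
  have := rsummableD sp (rsummableZ (-1) sq).
  by congr rsummable; apply/funext => i; rewrite upq mulN1r.
have sNu : rsummable (fun i => - u i).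
  by apply: rsummable_le su => i; rewrite normrN.
have fin (w : I -> R) : (forall i, 0 <= w i) -> rsummable w ->
    (\esum_(i in [set: I]) (w i)%:E)%E \is a fin_num.
  move=> w0 sw; have := rsum_pos_fin sw.
  by under eq_esum do rewrite max_l//.
have fu := rsum_pos_fin su; have fNu := rsum_pos_fin sNu.
have fp := fin _ p0 sp; have fq := fin _ q0 sq.
apply/eqP; rewrite /rsum subr_eq addrAC eq_sym subr_eq; apply/eqP.
rewrite -!fineD//; congr fine.
have m0 (w : I -> R) i : (0 <= (Num.max (w i) 0)%:E)%E.
  by rewrite lee_fin le_max lexx orbT.
rewrite -!esumD; try by move=> ? _; first [exact: m0|exact: (m0 (fun i => - u i))|rewrite lee_fin].
apply: eq_esum => i _; rewrite -!EFinD; congr EFin.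
rewrite upq; have [h|h] := lerP (p i) (q i).
  by rewrite (max_r (_ : p i - q i <= 0)) ?subr_le0// max_l ?oppr_ge0 ?subr_le0//; 
     rewrite opprB addrC subrK add0r.
rewrite (max_l (_ : 0 <= p i - q i)) ?subr_ge0 ?ltW// max_r ?oppr_le0 ?subr_ge0 ?ltW//.
by rewrite addr0 subrK.
Qed.

Lemma rsumD (u v : I -> R) : rsummable u -> rsummable v ->
  rsum (fun i => u i + v i) = rsum u + rsum v.
Proof.
move=> su sv.
have sN (w : I -> R) : rsummable w -> rsummable (fun i => - w i).
  by move=> sw; apply: rsummable_le sw => i; rewrite normrN.
have sm (w : I -> R) : rsummable w -> rsummable (fun i => Num.max (w i) 0).
  move=> sw; apply: rsummable_le sw => i.
  by rewrite ger0_norm ?le_max ?lexx ?orbT// ge_max ler_norm normr_ge0.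
have m0 (w : I -> R) i : 0 <= Num.max (w i) 0 by rewrite le_max lexx orbT.
have mE (w : I -> R) i : w i = Num.max (w i) 0 - Num.max (- w i) 0.
  have [h|h] := lerP (w i) 0; first by rewrite max_l ?oppr_ge0// opprK add0r.
  by rewrite max_r ?oppr_le0 ?subr0 ?ltW.
rewrite (@rsum_split _ (fun i => Num.max (u i) 0 + Num.max (v i) 0)
   (fun i => Num.max (- u i) 0 + Num.max (- v i) 0)).
- under eq_esum do rewrite EFinD.
  under [X in _ - fine X]eq_esum do rewrite EFinD.
  rewrite !esumD; try by move=> ? _; first [exact: m0|exact: (m0 (fun i => - u i))|exact: (m0 (fun i => - v i))].
  rewrite !fineD; try by [exact: rsum_pos_fin|apply: rsum_pos_fin; exact: sN].
  by rewrite /rsum opprD addrACA.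
- by move=> i; apply: addr_ge0.
- by move=> i; apply: addr_ge0; [exact: (m0 (fun i => - u i))|exact: (m0 (fun i => - v i))].
- by move=> i; rewrite {1}(mE u) {1}(mE v) opprD addrACA.
- by apply: rsummableD; apply: sm.
- by apply: rsummableD; apply: sm; apply: sN.
Qed.

Lemma rsumN (u : I -> R) : rsum (fun i => - u i) = - rsum u.
Proof. rewrite /rsum opprB; congr (_ - fine _).
by apply: eq_esum => i _; rewrite opprK. Qed.

Lemma esumZ (a : R) (w : I -> R) : 0 <= a -> (forall i, 0 <= w i) ->
  (\esum_(i in [set: I]) (a * w i)%:E = a%:E * \esum_(i in [set: I]) (w i)%:E)%E.
Proof.
move=> a0 w0; rewrite /esum -ereal_supZl// ?image_comp//; last first.
  by apply/set0P; exists (\sum_(x \in set0) (w x)%:E)%E; exists set0 => //; split.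
congr ereal_sup; apply: eq_imagel => A [fA _] /=.
by rewrite ge0_mule_fsumr// => i; rewrite lee_fin.
Qed.

Lemma rsumZ (a : R) (u : I -> R) : rsummable u ->
  rsum (fun i => a * u i) = a * rsum u.
Proof.
wlog a0 : a / 0 <= a.
  move=> H su; have [/H->//|/ltW a0] := leP 0 a.
  rewrite -[LHS]opprK -rsumN.
  under eq_fun do rewrite -mulNr.
  by rewrite H ?oppr_ge0// mulNr opprK.
move=> su; rewrite /rsum.
have m0 (w : I -> R) i : 0 <= Num.max (w i) 0 by rewrite le_max lexx orbT.
have mE (w : I -> R) i : Num.max (a * w i) 0 = a * Num.max (w i) 0.
  by rewrite -[X in Num.max _ X](mulr0 a) -maxr_pMr.
under eq_esum do rewrite mE.
under [X in _ - fine X]eq_esum do rewrite -mulrN (mE (fun i => - u i)).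
rewrite !esumZ//; try by move=> ?; first [exact: m0|exact: (m0 (fun i => - u i))].
rewrite !fineM//= -?mulrBr//; try exact: rsum_pos_fin.
by apply: (@rsum_pos_fin (fun i => - u i)); apply: rsummable_le su => i; rewrite normrN.
Qed.

End AbsSum.

Section L2.
Variables (R : realType) (V : choiceType).
Implicit Types f g : V -> R[i].

Lemma rnormC (W : normedZmodType R[i]) (x : W) : ((rnorm x)%:C)%C = `|x|.
Proof. by rewrite /rnorm RRe_real// normr_real. Qed.

Lemma rnorm_ge0 (W : normedZmodType R[i]) (x : W) : 0 <= rnorm x.
Proof. by rewrite -lecR rnormC normr_ge0. Qed.

Lemma rnormM (z w : R[i]) : rnorm (z * w) = rnorm z * rnorm w.
Proof. by apply: complexI; rewrite rmorphM/= !rnormC normrM. Qed.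

Lemma rnormD (W : normedZmodType R[i]) (x y : W) :
  rnorm (x + y) <= rnorm x + rnorm y.
Proof. by rewrite -lecR rmorphD/= !rnormC ler_normD. Qed.

Lemma rnormJ (z : R[i]) : rnorm (z^*) = rnorm z.
Proof. by apply: complexI; rewrite !rnormC norm_conjC. Qed.

Lemma rnorm_Re (z : R[i]) : `|complex.Re z| <= rnorm z.
Proof. by rewrite -lecR rnormC normc_ge_Re. Qed.

Lemma rnorm_Im (z : R[i]) : `|complex.Im z| <= rnorm z.
Proof.
have -> : rnorm z = rnorm (z * 'i%C) by rewrite rnormM /rnorm normc_def/= expr0n expr1n add0r sqrtr1 mulr1.
have -> : `|complex.Im z| = `|complex.Re (z * 'i%C)|.
  by case: z => a b /=; rewrite mulr0 mulr1 sub0r normrN.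
exact: rnorm_Re.
Qed.

Definition sqnorm f : \bar R := (\esum_(v in [set: V]) (rnorm (f v) ^+ 2)%:E)%E.

Lemma sqnorm_ge0 f : (0 <= sqnorm f)%E.
Proof. by apply: esum_ge0 => v _; rewrite lee_fin sqr_ge0. Qed.

Definition l2_pred : {pred (V -> R[i])} := fun f => `[< (sqnorm f < +oo)%E >].

Lemma l2_predE f : f \in l2_pred -> (sqnorm f < +oo)%E.
Proof. by move/asboolP. Qed.

Lemma sq_summable f : f \in l2_pred -> rsummable (fun v => rnorm (f v) ^+ 2).
Proof.
move/l2_predE; apply: le_lt_trans; apply: le_esum => v _.
by rewrite ger0_norm// sqr_ge0.
Qed.

Lemma l2_submod_closed : submod_closed l2_pred.
Proof.
split.
  by apply/asboolP; rewrite /sqnorm esum1 ?ltry// => v _; rewrite /rnorm normr0 expr0n.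
move=> a f g f2 g2; apply/asboolP.
have /= := rsummableZ 2 (rsummableD (rsummableZ (rnorm a ^+ 2) (sq_summable f2)) (sq_summable g2)).
apply: le_lt_trans; apply: le_esum => v _; rewrite lee_fin.
apply: le_trans (ler_norm _).
have h : rnorm ((a *: f + g) v) <= rnorm a * rnorm (f v) + rnorm (g v).
  by rewrite -rnormM; exact: rnormD.
rewrite -exprMn.
have : rnorm ((a *: f + g) v) ^+ 2 <= (rnorm a * rnorm (f v) + rnorm (g v)) ^+ 2.
  by rewrite ler_pXn2r// ?nnegrE ?rnorm_ge0// addr_ge0 ?mulr_ge0 ?rnorm_ge0.
move/le_trans; apply.
rewrite -subr_ge0.
set p := rnorm a * rnorm (f v); set q := rnorm (g v).
have -> : 2 * (p ^+ 2 + q ^+ 2) - (p + q) ^+ 2 = (p - q) ^+ 2 by ring.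
exact: sqr_ge0.
Qed.


HB.instance Definition _ :=
  GRing.isSubmodClosed.Build R[i] (V -> R[i]) l2_pred l2_submod_closed.

Record l2 := L2 { l2_fun :> V -> R[i]; l2_funP : l2_fun \in l2_pred }.
HB.instance Definition _ := [isSub for l2_fun].
HB.instance Definition _ := [Choice of l2 by <:].
HB.instance Definition _ := [SubChoice_isSubLmodule of l2 by <:].

Lemma l2_ext (f g : l2) : (forall v, f v = g v) -> f = g.
Proof. by move=> h; apply: val_inj; apply/funext. Qed.

Lemma l2_addE (f g : l2) v : (f + g) v = f v + g v. Proof. by []. Qed.
Lemma l2_scaleE a (f : l2) v : (a *: f) v = a * f v. Proof. by []. Qed.

Definition l2_inner (f g : l2) : R[i] := csum (fun v => f v * (g v)^*).

Lemma l2_prod_summable (f g : l2) :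
  rsummable (fun v => complex.Re (f v * (g v)^*)) /\
  rsummable (fun v => complex.Im (f v * (g v)^*)).
Proof.
have h := rsummableD (sq_summable (l2_funP f)) (sq_summable (l2_funP g)).
have k v : rnorm (f v * (g v)^*) <= `|rnorm (f v) ^+ 2 + rnorm (g v) ^+ 2|.
  rewrite rnormM rnormJ ger0_norm ?addr_ge0 ?sqr_ge0//.
  have := rnorm_ge0 (f v); have := rnorm_ge0 (g v); nra.
by split; apply: rsummable_le h => v; apply: le_trans (k v);
  [exact: rnorm_Re|exact: rnorm_Im].
Qed.

Lemma csumP (a : R[i]) (u w : V -> R[i]) :
  rsummable (fun v => complex.Re (u v)) -> rsummable (fun v => complex.Im (u v)) ->
  rsummable (fun v => complex.Re (w v)) -> rsummable (fun v => complex.Im (w v)) ->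
  csum (fun v => a * u v + w v) = a * csum u + csum w.
Proof.
case: a => a b ur ui wr wi; rewrite /csum.
have -> : (fun v => complex.Re ((a +i* b)%C * u v + w v)) =
  (fun v => (a * complex.Re (u v) + (- b) * complex.Im (u v)) + complex.Re (w v)).
  by apply/funext => v; case: (u v) => x y; case: (w v) => z t /=; ring.
have -> : (fun v => complex.Im ((a +i* b)%C * u v + w v)) =
  (fun v => (a * complex.Im (u v) + b * complex.Re (u v)) + complex.Im (w v)).
  by apply/funext => v; case: (u v) => x y; case: (w v) => z t /=; ring.
have zur := rsummableZ a ur; have zui := rsummableZ a ui.
have zur' := rsummableZ b ur; have zui' := rsummableZ (- b) ui.
rewrite (rsumD (rsummableD zur zui') wr) (rsumD zur zui').
rewrite (rsumD (rsummableD zui zur') wi) (rsumD zui zur').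
rewrite (rsumZ a ur) (rsumZ a ui) (rsumZ b ur) (rsumZ (- b) ui).
by apply/eqP; rewrite eq_complex /=; apply/andP; split; apply/eqP; ring.
Qed.

Lemma l2_inner_conj (f g : l2) : l2_inner f g = (l2_inner g f)^*.
Proof.
rewrite /l2_inner /csum.
have E v : f v * (g v)^* = (g v * (f v)^*)^* by rewrite rmorphM /= conjCK mulrC.
have -> : (fun v => complex.Re (f v * (g v)^*)) = (fun v => complex.Re (g v * (f v)^*)).
  by apply/funext => v; rewrite E; case: (g v * _).
have -> : (fun v => complex.Im (f v * (g v)^*)) = (fun v => - complex.Im (g v * (f v)^*)).
  by apply/funext => v; rewrite E; case: (g v * _).
by rewrite rsumN.
Qed.

Lemma l2_innerPl (g : l2) : GRing.linear_for *%R (l2_inner ^~ g).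
Proof.
move=> a f1 f2; rewrite /l2_inner.
have [h1 h2] := l2_prod_summable f1 g; have [h3 h4] := l2_prod_summable f2 g.
rewrite -csumP//; congr csum; apply/funext => v.
by rewrite l2_addE l2_scaleE mulrDl mulrA.
Qed.

Lemma l2_innerPr (f : l2) : GRing.linear_for (Num.conj \; *%R) (l2_inner f).
Proof.
move=> a g1 g2; rewrite l2_inner_conj l2_innerPl rmorphD rmorphM/=.
by rewrite -!l2_inner_conj.
Qed.

Lemma l2_inner_sqnorm (f : l2) : l2_inner f f = ((fine (sqnorm f))%:C)%C.
Proof.
rewrite /l2_inner /csum.
have E v : f v * (f v)^* = ((rnorm (f v) ^+ 2)%:C)%C.
  by rewrite -normCK -rnormC rmorphXn.
have -> : (fun v => complex.Re (f v * (f v)^*)) = (fun v => rnorm (f v) ^+ 2).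
  by apply/funext => v; rewrite E.
have -> : (fun v => complex.Im (f v * (f v)^*)) = (fun v => 0).
  by apply/funext => v; rewrite E.
apply/eqP; rewrite eq_complex /=; apply/andP; split; apply/eqP.
  rewrite /rsum -[RHS]subr0; congr (fine _ - _).
    by apply: eq_esum => v _; rewrite max_l// sqr_ge0.
  by rewrite esum1// => v _; rewrite max_r// oppr_le0 sqr_ge0.
by rewrite /rsum oppr0 subrr.
Qed.

Lemma l2_inner_gt0 (f : l2) : f != 0 -> 0 < l2_inner f f.
Proof.
move=> f0; rewrite l2_inner_sqnorm (ltcR 0) fine_gt0// (l2_predE (l2_funP f)) andbT.
have /existsNP[v fv] : ~ forall v, f v = 0.
  by move=> h; move/eqP: f0; apply; apply: l2_ext.
apply: (@lt_le_trans _ _ (rnorm (f v) ^+ 2)%:E).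
  rewrite lte_fin exprn_gt0// -ltcR rnormC normr_gt0; exact/eqP.
apply: esum_ge; exists [set v]; first by split.
by rewrite fsbig_set1.
Qed.

HB.instance Definition _ := bilinear_isBilinear.Build R[i] l2 l2 R[i]
  *%R (Num.conj \; *%R) l2_inner (conj l2_innerPl l2_innerPr).
Lemma l2_inner_herm (f g : l2) : l2_inner f g = (-1) ^+ false * Num.conj (l2_inner g f).
Proof. by rewrite expr0 mul1r l2_inner_conj. Qed.
HB.instance Definition _ := isHermitianSesquilinear.Build R[i] l2 false Num.conj l2_inner l2_inner_herm.
HB.instance Definition _ := isDotProduct.Build R[i] l2 l2_inner l2_inner_gt0.


End L2.

Section L2Normed.
Variables (R : realType) (V : choiceType).
Local Notation L := (l2 R V).
Implicit Types f g : L.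

Let l2_norm f : R[i] := sqrtC (l2_inner f f).

Let l2_normD f g : l2_norm (f + g) <= l2_norm f + l2_norm g.
Proof. exact: (dot_triangle (@l2_inner R V)). Qed.

Let l2_normZ (a : R[i]) f : l2_norm (a *: f) = `|a| * l2_norm f.
Proof.
rewrite /l2_norm (dnormZ (@l2_inner R V)) sqrtCM ?nnegrE ?exprn_ge0 ?dnorm_ge0//.
by rewrite sqrCK.
Qed.

Let l2_norm0 f : l2_norm f = 0 -> f = 0.
Proof. by move=> /eqP; rewrite (sqrt_dnorm_eq0 (@l2_inner R V)) => /eqP. Qed.

HB.instance Definition _ := Lmodule_isNormed.Build R[i] L l2_normD l2_normZ l2_norm0.

Lemma l2_inner_norm f : l2_inner f f = `|f| ^+ 2.
Proof. have -> : `|f| = l2_norm f by []. by rewrite sqrtCK. Qed.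

Lemma l2_sqnorm f : ((rnorm f ^+ 2)%:E = sqnorm f)%E.
Proof.
rewrite -[RHS]fineK; last first.
  by rewrite ge0_fin_numE ?sqnorm_ge0//; exact/l2_predE/l2_funP.
congr EFin; apply: complexI.
by rewrite -l2_inner_sqnorm l2_inner_norm rmorphXn /= rnormC.
Qed.

Lemma l2_coord f v : rnorm (f v) <= rnorm f.
Proof.
rewrite -(@ler_pXn2r _ 2)// ?nnegrE ?rnorm_ge0// -lee_fin l2_sqnorm.
by apply: esum_ge; exists [set v]; rewrite ?fsbig_set1//; split.
Qed.

Lemma rnorm_sqE (z : R[i]) : rnorm z ^+ 2 = complex.Re z ^+ 2 + complex.Im z ^+ 2.
Proof. by rewrite /rnorm normc_def/= sqr_sqrtr// addr_ge0 ?sqr_ge0. Qed.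

Lemma l2_complete (F : set_system L) : ProperFilter F -> cauchy F -> cvg F.
Proof.
move=> FF /cauchyP Fc.
have {}Fc (e : R) : 0 < e -> exists f, F [set g | rnorm (f - g) < e].
  move=> e0; have [|f Ff] := Fc (e%:C)%C; first by rewrite ltcR.
  exists f; apply: filterS Ff => g; rewrite -ball_normE /=.
  by rewrite -rnormC ltcR.
have cF (h : R[i] -> R) v : (forall z w, `|h z - h w| <= rnorm (z - w)) ->
    cvg ((fun f : L => h (f v)) @ F).
  move=> hh; apply/cauchy_cvgP/cauchy_exP => e e0.
  have [f Ff] := Fc e e0; exists (h (f v)).
  rewrite /fmap /=; apply: (filterS _ Ff) => g /= fg.
  rewrite -ball_normE /=; apply: le_lt_trans fg.
  exact: le_trans (hh (f v) (g v)) (l2_coord (f - g) v).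
have cRe v : cvg ((fun f : L => complex.Re (f v)) @ F).
  by apply: cF => z w; rewrite -raddfB; exact: rnorm_Re.
have cIm v : cvg ((fun f : L => complex.Im (f v)) @ F).
  by apply: cF => z w; rewrite -raddfB; exact: rnorm_Im.
pose l v : R[i] := (lim ((fun f : L => complex.Re (f v)) @ F) +i*
                    lim ((fun f : L => complex.Im (f v)) @ F))%C.
have bound f (e : R) : 0 < e -> F [set g | rnorm (f - g) < e] ->
    (sqnorm (fun v => f v - l v)%R <= (e ^+ 2)%:E)%E.
  move=> e0 Ff; apply: ge_ereal_sup => _ [X [finX _] <-].
  rewrite fsbig_finite//= sumEFin lee_fin.
  set s := finmap.enum_fset _.
  have cs : (fun g : L => \sum_(v <- s) rnorm (f v - g v) ^+ 2) @ F -->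
      \sum_(v <- s) rnorm (f v - l v) ^+ 2.
    elim: s => [|v s IH].
      rewrite big_nil; under eq_fun do rewrite big_nil; exact: cvg_cst.
    rewrite big_cons; under eq_fun do rewrite big_cons.
    apply: cvgD IH.
    have E (z w : R[i]) : rnorm (z - w) ^+ 2 =
        (complex.Re z - complex.Re w) * (complex.Re z - complex.Re w) +
        (complex.Im z - complex.Im w) * (complex.Im z - complex.Im w).
      by rewrite rnorm_sqE !raddfB /= !expr2.
    rewrite E; under [X in X @ F]eq_fun do rewrite E.
    have dRe : (fun g : L => complex.Re (f v) - complex.Re (g v)) @ F -->
        complex.Re (f v) - complex.Re (l v) by apply: cvgB; [exact: cvg_cst|exact: cRe].
    have dIm : (fun g : L => complex.Im (f v) - complex.Im (g v)) @ F -->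
        complex.Im (f v) - complex.Im (l v) by apply: cvgB; [exact: cvg_cst|exact: cIm].
    by apply: cvgD; apply: cvgM.
  apply: (cvgr_to_le cs); apply: filterS Ff => g /= fg.
  apply: (@le_trans _ _ (rnorm (f - g) ^+ 2)); last first.
    by rewrite ler_pXn2r// ?nnegrE ?rnorm_ge0 ?(ltW e0)// ltW.
  rewrite -lee_fin l2_sqnorm -sumEFin; apply: esum_ge.
  by exists X => //; rewrite fsbig_finite.
have [f0 Ff0] := Fc 1 ltr01.
have l2l : l \in @l2_pred R V.
  have h : (fun v => f0 v - l v) \in @l2_pred R V.
    by apply/asboolP; apply: le_lt_trans (bound _ _ ltr01 Ff0) _; rewrite ltry.
  have -> : l = \val f0 - (fun v => f0 v - l v).
    by apply/funext => v; rewrite /= !fctE opprB addrC subrK.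
  by rewrite rpredB// l2_funP.
apply/cvg_ex; exists (L2 l2l); apply/cvgrPdist_le => e e0.
have eE : e = ((rnorm e)%:C)%C by rewrite rnormC gtr0_norm.
have re0 : 0 < rnorm e / 2 by rewrite divr_gt0// -ltcR -eE.
have [f Ff] := Fc _ re0; apply: filterS (Ff) => g /= fg.
rewrite eE -rnormC lecR.
have h : rnorm (f - L2 l2l) <= rnorm e / 2.
  rewrite -(@ler_pXn2r _ 2)// ?nnegrE ?rnorm_ge0 ?(ltW re0)// -lee_fin l2_sqnorm.
  exact: bound.
have -> : L2 l2l - g = (f - g) - (f - L2 l2l) by rewrite opprB [RHS]addrC addrA subrK.
apply: le_trans (rnormD _ _) _.
have -> : rnorm (- (f - L2 l2l)) = rnorm (f - L2 l2l) by rewrite /rnorm normrN.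
by rewrite (splitr (rnorm e)) lerD// ltW.
Qed.

HB.instance Definition _ := Uniform_isComplete.Build L l2_complete.
HB.instance Definition _ :=
  CompleteNormedModule_isHilbert.Build R L (l2_inner_norm).
End L2Normed.

Section BoundedOperators.
Variable R : realType.

(* B(H, K): continuous, equivalently bounded, linear maps. *)
Record bop (H K : normedModType R[i]) := Bop {
  bop_linear :> {linear H -> K};
  bop_continuous : continuous bop_linear }.

HB.instance Definition _ H K := gen_eqMixin (bop H K).
HB.instance Definition _ H K := gen_choiceMixin (bop H K).

Lemma null_bop_continuous (H K : normedModType R[i]) :
  continuous (\0 : {linear H -> K}).
Proof. by move=> x; exact: cvg_cst. Qed.
Definition null_bop (H K : normedModType R[i]) : bop H K :=
  Bop (@null_bop_continuous H K).

Lemma id_bop_continuous (H : normedModType R[i]) :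
  continuous (idfun : {linear H -> H}).
Proof. by move=> x; exact: cvg_id. Qed.
Definition id_bop (H : normedModType R[i]) : bop H H :=
  Bop (@id_bop_continuous H).

Lemma comp_bop_continuous (H K L : normedModType R[i])
    (B : bop K L) (A : bop H K) :
  continuous (B \o A : {linear H -> L}).
Proof.
by move=> x; apply: continuous_comp; exact: bop_continuous.
Qed.
Definition comp_bop (H K L : normedModType R[i]) (B : bop K L) (A : bop H K) :
  bop H L := Bop (@comp_bop_continuous H K L B A).

Definition pow_bop (H : normedModType R[i]) (A : bop H H) (n : nat) : bop H H :=
  iter n (comp_bop A) (id_bop H).

End BoundedOperators.

Section Kernel.
Variables (R : realType) (H : hilbertType R) (K : normedModType R[i]).
Variable A : bop H K.

Definition ker_pred : {pred H} := fun x => A x == 0.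

Let ker_submod_closed : submod_closed ker_pred.
Proof.
split; first by apply/eqP; rewrite linear0.
move=> a x y /eqP x0 /eqP y0.
by apply/eqP; rewrite linearP x0 y0 scaler0 addr0.
Qed.

HB.instance Definition _ :=
  GRing.isSubmodClosed.Build R[i] H ker_pred ker_submod_closed.

Record ker := Ker { ker_val :> H; ker_valP : ker_val \in ker_pred }.
HB.instance Definition _ := [isSub for ker_val].
HB.instance Definition _ := [Choice of ker by <:].
HB.instance Definition _ := [SubChoice_isSubLmodule of ker by <:].

Let ker_norm (x : ker) : R[i] := `|ker_val x|.

Let ker_normD x y : ker_norm (x + y) <= ker_norm x + ker_norm y.
Proof. exact: ler_normD. Qed.
Let ker_normZ (a : R[i]) x : ker_norm (a *: x) = `|a| * ker_norm x.
Proof. exact: normrZ. Qed.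
Let ker_norm0 x : ker_norm x = 0 -> x = 0.
Proof. by move=> /eqP; rewrite normr_eq0 => /eqP h; exact: val_inj. Qed.

HB.instance Definition _ :=
  Lmodule_isNormed.Build R[i] ker ker_normD ker_normZ ker_norm0.

Lemma ker_normE (x : ker) : `|x| = `|ker_val x|. Proof. by []. Qed.

Lemma ker_complete (F : set_system ker) : ProperFilter F -> cauchy F -> cvg F.
Proof.
move=> FF /cauchyP Fc.
have /cauchy_cvgP cF : cauchy (ker_val @ F).
  apply/cauchy_exP => e e0; have [x Fx] := Fc e e0; exists (ker_val x).
  rewrite /fmap /=; apply: (filterS _ Fx) => y /=.
  by rewrite -!ball_normE /=.
set l := lim (ker_val @ F) in cF.
have l0 : l \in ker_pred.
  apply/eqP.
  have h1 : A \o ker_val @ F --> A l.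
    by apply: cvg_comp cF _; exact: bop_continuous.
  have h2 : A \o ker_val @ F --> (0 : K).
    have -> : A \o ker_val = (fun=> 0); last exact: cvg_cst.
    by apply/funext => x /=; apply/eqP; exact: ker_valP.
  exact: cvg_unique h1 h2.
apply/cvg_ex; exists (Ker l0); apply/cvgrPdist_le => e e0.
move/cvgrPdist_le : cF => /(_ e e0).
by rewrite /fmap /=; apply: filterS.
Qed.

HB.instance Definition _ := Uniform_isComplete.Build ker ker_complete.

Definition ker_inner (x y : ker) : R[i] := inner (ker_val x) (ker_val y).

Let ker_innerPl (y : ker) : GRing.linear_for *%R (ker_inner ^~ y).
Proof. by move=> a x z; rewrite /ker_inner /= linearPl. Qed.
Let ker_innerPr (x : ker) : GRing.linear_for (Num.conj \; *%R) (ker_inner x).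
Proof. by move=> a y z; rewrite /ker_inner /= linearPr. Qed.
HB.instance Definition _ := bilinear_isBilinear.Build R[i] ker ker R[i]
  *%R (Num.conj \; *%R) ker_inner (conj ker_innerPl ker_innerPr).
Let ker_inner_herm (x y : ker) :
  ker_inner x y = (-1) ^+ false * Num.conj (ker_inner y x).
Proof. exact: hermC. Qed.
HB.instance Definition _ := isHermitianSesquilinear.Build R[i] ker false
  Num.conj ker_inner ker_inner_herm.
Let ker_inner_gt0 (x : ker) : x != 0 -> 0 < ker_inner x x.
Proof. by move=> x0; rewrite /ker_inner neq0_dnorm_gt0. Qed.
HB.instance Definition _ :=
  isDotProduct.Build R[i] ker ker_inner ker_inner_gt0.
Let ker_inner_norm (x : ker) : ker_inner x x = `|x| ^+ 2.
Proof. by rewrite /ker_inner inner_norm. Qed.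
HB.instance Definition _ :=
  CompleteNormedModule_isHilbert.Build R ker ker_inner_norm.

Lemma ker_val_continuous : continuous (ker_val : ker -> H).
Proof.
move=> x; have FF := nbhs_filter x; apply/(@cvgrPdist_le _ _ _ _ FF) => e e0.
have : (@idfun ker) y @[y --> x] --> x by exact: cvg_id.
by move=> /cvgrPdist_le /(_ e e0).
Qed.

Lemma ker_val_linear : linear (ker_val : ker -> H). Proof. by []. Qed.
HB.instance Definition _ := GRing.isLinear.Build R[i] ker H _ ker_val ker_val_linear.

Definition ker_incl : bop ker H := Bop (ker_val_continuous : continuous (ker_val : {linear ker -> H})).

End Kernel.

Section HilbertOperators.
Variable R : realType.
Implicit Types H K : hilbertType R.

(* The operators below are selected by their defining properties; the default
   value is only taken when no bounded operator has the property, which for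
   adjoint and orth_proj never happens. *)
Definition adjoint H K (A : bop H K) : bop K H :=
  xget (null_bop K H) [set B : bop K H | forall x y, inner (A x) y = inner x (B y)].

Definition orth_proj H K (A : bop H K) : bop H (ker A) :=
  xget (null_bop H (ker A))
    [set P | forall x (y : ker A), inner (x - ker_val (P x)) (ker_val y) = 0].

Definition is_inverse H (A B : bop H H) := cancel A B /\ cancel B A.

Definition inv_bop H (A : bop H H) : bop H H := xget (null_bop H H) (is_inverse A).

Definition left_invertible H (A : bop H H) := exists B : bop H H, cancel A B.

Definition cauchy_dual H (A : bop H H) : bop H H :=
  comp_bop A (inv_bop (comp_bop (adjoint A) A)).

Definition spectrum H (A : bop H H) : set R[i] :=
  [set z | ~ exists B : bop H H, cancel (fun x => A x - z *: x) B /\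
                                 cancel B (fun x => A x - z *: x)].

Definition spectral_radius H (A : bop H H) : \bar R :=
  ereal_sup [set (rnorm z)%:E | z in spectrum A].

Definition unitary H K (U : {linear H -> K}) :=
  (forall x y, inner (U x) (U y) = inner x y) /\ (forall y, exists x, U x = y).

Definition linear_span H (A : set H) : set H :=
  [set x | exists (n : nat) (c : 'I_n -> R[i]) (a : 'I_n -> H),
     (forall i, A (a i)) /\ x = \sum_(i < n) c i *: a i].

Definition closed_span H (A : set H) : set H := closure (linear_span A).

Definition orthonormal_basis H (B : set H) :=
  (forall x y, B x -> B y -> inner x y = (x == y)%:R) /\
  closed_span B = [set: H].

(* T = \sum_(i in D) F i, unconditionally, in the operator norm. *)
Definition opnorm_sum H K (I : choiceType) (D : set I) (F : I -> H -> K)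
    (T : H -> K) :=
  forall eps : R, 0 < eps -> exists J0 : {fset I},
    [set` J0] `<=` D /\
    forall J : {fset I}, [set` J0] `<=` [set` J] -> [set` J] `<=` D ->
    forall x, rnorm (T x - \sum_(i <- enum_fset J) F i x) <= eps * rnorm x.

End HilbertOperators.

Section Trees.
Variables (V : choiceType) (e : rel V).

Definition is_root (v : V) := forall u, ~~ e u v.

Record directed_tree : Prop := DirectedTree {
  tree_irrefl : irreflexive e;
  tree_connected : forall u v, u != v ->
    exists p, path (fun a b => e a b || e b a) u p /\ last u p = v;
  tree_acyclic : forall s : seq V, (1 < size s)%N -> uniq s -> ~~ cycle e s;
  tree_parent : forall v, ~ is_root v -> exists! u, e u v
}.

Definition leafless := forall u, exists v, e u v.

(* Equal to v itself when v is a root. *)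
Definition par (v : V) : V := xget v [set u | e u v].

Definition Chi (W : set V) : set V := [set v | exists2 u, W u & e u v].

Definition Chin (n : nat) (W : set V) : set V := iter n Chi W.

Definition depth (root u : V) : nat := xget 0%N [set n | Chin n [set root] u].

Definition branching_vertices : set V :=
  [set u | exists v w, [/\ v != w, e u v & e u w]].

Definition branching_index (R : realType) (root : V) : \bar R :=
  if `[< branching_vertices = set0 >] then 0%E
  else (1 + ereal_sup [set (depth root w)%:R%:E | w in branching_vertices])%E.

End Trees.

Section WeightedShifts.
Variables (R : realType) (V : choiceType).

Lemma l2_basis_subproof (v : V) :
  (fun w : V => (w == v)%:R : R[i]) \in @l2_pred R V.
Proof.
apply/asboolP; rewrite /sqnorm.
rewrite (_ : \esum_(w in _) _ = \esum_(w in [set v]) 1%E)%E.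
  by rewrite esum_set1 ?ltry.
rewrite [RHS]esum_mkcond; apply: eq_esum => w _.
rewrite in_set1 -(_ : rnorm (1 : R[i]) ^+ 2 = 1); last first.
  by rewrite /rnorm normr1 /= expr1n.
case: (w == v); first by [].
by rewrite /rnorm normr0 /= expr0n.
Qed.
Definition l2_basis (v : V) : l2 R V := L2 (l2_basis_subproof v).

Variable e : rel V.
Implicit Type lam : V -> R.

Definition wshift lam (f : V -> R[i]) : V -> R[i] := fun v =>
  if `[< is_root e v >] then 0 else ((lam v)%:C)%C * f (par e v).

Definition is_weighted_shift lam (S : bop (l2 R V) (l2 R V)) :=
  (forall v, ~ is_root e v -> 0 < lam v) /\
  forall f : l2 R V, S f = wshift lam f :> (V -> R[i]).

Definition dual_weight lam (S : bop (l2 R V) (l2 R V)) (v : V) : R :=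
  lam v / rnorm (S (l2_basis (par e v))) ^+ 2.

Definition level_band (root : V) (k n : nat) : set V :=
  \bigcup_(j in [set j | (n <= j <= k + n)%N]) Chin e j [set root].

(* mu stands for the weights of the Cauchy dual. *)
Definition radius_sum (mu : V -> R) (root : V) (k n : nat) : \bar R :=
  (\esum_(v in level_band root k n)
     ((\prod_(i < n) mu (iter i (par e) v)) ^+ 2)%:E)%E.

(* The inverse on \bar R sends +oo to 0, so the formula is literal even when
   radius_sum is infinite; it is a number built from numbers, as intended, only
   when every radius_sum with n >= 1 is finite. *)
Definition convergence_radius (mu : V -> R) (root : V) (k : nat) : \bar R :=
  limn_einf (fun n => (poweR (radius_sum mu root k n) (2 * n%:R)^-1)^-1)%E.

End WeightedShifts.

Section FunctionSpaces.
Variables (R : realType) (D : set R[i]) (E : hilbertType R).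

(* A reproducing kernel Hilbert space of E-valued functions on D: the element h
   is the function z |-> rk_eval z h on D, which determines it by rk_ext, and
   point evaluations are bounded.  Values of rk_eval outside D are junk. *)
Record rkhs := Rkhs {
  rk_space :> hilbertType R;
  rk_eval : R[i] -> bop rk_space E;
  rk_ext : forall h1 h2, (forall z, D z -> rk_eval z h1 = rk_eval z h2) -> h1 = h2 }.

Definition represents (H : rkhs) (h : H) (f : R[i] -> E) :=
  forall z, D z -> rk_eval H z h = f z.

Definition holomorphic (H : rkhs) := forall (h : H) z, D z ->
  derivable (fun w : R[i]^o => rk_eval H w h) z 1.

Definition z_invariant (H : rkhs) := forall h : H, exists h' : H,
  represents h' (fun z => z *: rk_eval H z h).

(* The operator M_z, meaningful when H is z-invariant. *)
Definition mult_z (H : rkhs) (h : H) : H :=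
  xget 0 [set h' : H | represents h' (fun z => z *: rk_eval H z h)].

Definition constants (H : rkhs) : set H :=
  [set h | exists g : E, represents h (fun=> g)].

Definition polyfun (a : seq E) (z : R[i]) : E :=
  \sum_(i < size a) z ^+ i *: a`_i.

End FunctionSpaces.

Arguments constants {R D E} H _.

Definition disc (R : realType) (r : \bar R) : set R[i] := [set z | ((rnorm z)%:E < r)%E].

(* The pairs (j, k) with j, k >= 1 and |j - k| <= b. *)
Definition band (b : nat) : set (nat * nat) :=
  [set p | [/\ (1 <= p.1)%N, (1 <= p.2)%N,
               (p.1 <= p.2 + b)%N & (p.2 <= p.1 + b)%N]].

(* Main.v *)
Require Import Defs.
From HB Require Import structures.
From mathcomp Require Import all_boot all_order all_algebra finmap.
From mathcomp Require Import complex.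
From mathcomp Require Import boolp classical_sets functions cardinality fsbigop.
From mathcomp Require Import reals ereal topology normedtype sequences esum.
From mathcomp Require Import derive exp ring lra.

Set Implicit Arguments.
Unset Strict Implicit.
Unset Printing Implicit Defensive.

Import Order.TTheory GRing.Theory Num.Theory.
Import numFieldNormedType.Exports.

Local Open Scope classical_set_scope.
Local Open Scope ring_scope.

(** The function space is [l^2(V)] itself, and the unitary is the identity: only the
    way in which a vector is read as a function has to be found. Write [S'] for the
    Cauchy dual, [L] for its adjoint, [E] for [ker S^*] and [P] for the projection
    onto [E]. As [L] is a left inverse of [S] and [1 - S L = P] ([orth_proj_split]),
    every [f] is [sum_(n < N) S^n P L^n f + S^N L^N f]. The vector [f] is therefore
    read as the power series [sum_n z^n P L^n f] ([model_eval]): multiplication by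
    [z] becomes [S], because [P S = 0] and [L S = 1], and an element of [E] becomes
    constant, because [L] vanishes on [E].

    Convergence on the disc. The adjoint of [P L^n] is the restriction of [S'^n] to
    [E]. Elements of [E] live on the levels up to the branching index [k], so the
    coordinates of [S'^n g] are at most [|g|] times those of [S'^n b], where [b] is
    the indicator of these levels ([ker_growth]); and [|S'^n b|^2] is precisely the
    [n]-th sum in the definition of the radius of convergence ([radius_sumE]). The
    root test ([root_liminf_gt]) turns this into [|S'^n g| <= M p^n |g|] with
    [p |z| < 1] for each [z] in the disc. The one delicate point is that [b] is
    square summable ([top_levels_ex]).

    A vector is determined by its function. The identity theorem
    ([model_eval_coef0]) gives [P L^n f = 0] for all [n], hence [f = S^N L^N f] for
    all [N], and functions in the range of [S^N] vanish on the first [N] levels.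
    The same expansion is finite for a finitely supported [f], because [L] moves a
    basis vector one level towards the root; this gives the density of the polynomials, and shows
    that the basis vector at [v] is a polynomial whose coefficients vanish outside
    [depth v - k <= n <= depth v].

    The kernel is [model_eval z] composed with the adjoint of [model_eval w]. Its
    series in [z] and the conjugate of [w] is compared with partial double sums in
    operator norm ([kernel_opnorm_sum]), and its terms vanish off the band because
    [S'^j g] and [S'^k h] then have disjoint supports ([model_coef_band]).

    Finally, if [t > 0] is not in the spectrum of [S'], the vector [x] with
    [(S' - t) x = b] dominates all the [t^-(n+1) S'^n b], so the radius of convergence
    is at least [1/t] ([top_norm_resolvent], [root_liminf_ge]). The existence of
    adjoints, projections and Cauchy duals rests on a single minimisation argument,
    [energy_solution]. *)

(** * Norms and geometric convergence *)
Section Norms.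
Variable R : realType.
Implicit Types (H K : hilbertType R) (V : normedZmodType R[i]).

Lemma rnormZ (V : normedModType R[i]) (a : R[i]) (x : V) : rnorm (a *: x) = rnorm a * rnorm x.
Proof. by apply: complexI; rewrite rmorphM /= !rnormC normrZ. Qed.

Lemma rnormN V (x : V) : rnorm (- x) = rnorm x.
Proof. by rewrite /rnorm normrN. Qed.

Lemma rdistC V (x y : V) : rnorm (x - y) = rnorm (y - x).
Proof. by rewrite -rnormN opprB. Qed.

Lemma rnorm0 V : rnorm (0 : V) = 0.
Proof. by rewrite /rnorm normr0. Qed.

Lemma rnorm_eq0 V (x : V) : rnorm x <= 0 -> x = 0.
Proof.
move=> x0; apply/eqP; rewrite -normr_eq0 -rnormC.
by rewrite (_ : rnorm x = 0) //; apply/eqP; rewrite eq_le x0 rnorm_ge0.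
Qed.

Lemma rnormX (z : R[i]) n : rnorm (z ^+ n) = rnorm z ^+ n.
Proof. by apply: complexI; rewrite rmorphXn /= !rnormC normrX. Qed.

Lemma rnorm_real (a : R) : rnorm ((a%:C)%C : R[i]) = `|a|.
Proof. by rewrite /rnorm normc_def /= expr0n /= addr0 sqrtr_sqr. Qed.

Lemma rnorm_nat n : rnorm (n%:R : R[i]) = n%:R.
Proof. by rewrite -(rmorph_nat (real_complex R)) rnorm_real normr_nat. Qed.

Lemma rnorm_sum V (I : Type) (s : seq I) (P : pred I) (F : I -> V) :
  rnorm (\sum_(i <- s | P i) F i) <= \sum_(i <- s | P i) rnorm (F i).
Proof.
elim/big_ind2: _ => [|x1 x2 y1 y2 h1 h2|//]; first by rewrite rnorm0.
by apply: le_trans (rnormD _ _) _; exact: lerD.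
Qed.

Lemma innerC H (x y : H) : inner x y = (inner y x)^*.
Proof. by rewrite hermC expr0 mul1r. Qed.

Lemma inner_rnorm H (x : H) : inner x x = ((rnorm x ^+ 2)%:C)%C.
Proof. by rewrite inner_norm rmorphXn /= rnormC. Qed.

Lemma innerZl H (a : R[i]) (x y : H) : inner (a *: x) y = a * inner x y.
Proof. exact: linearZl_LR. Qed.

Lemma innerNr H (x y : H) : inner x (- y) = - inner x y.
Proof. by rewrite linearNr. Qed.

Lemma inner_CS H (x y : H) : rnorm (inner x y) <= rnorm x * rnorm y.
Proof.
rewrite -lecR rmorphM /= !rnormC.
have := dot_CauchySchwarz (@inner R H) x y.
by rewrite !inner_norm !sqrCK ?normr_ge0.
Qed.

Lemma inner_ext H (x y : H) : (forall z, inner z x = inner z y) -> x = y.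
Proof.
move=> h; apply/eqP; rewrite -subr_eq0 -(dnorm_eq0 (@inner R H)).
by rewrite linearBr /= h subrr.
Qed.

Lemma sqr_rnormD H (x y : H) :
  rnorm (x + y) ^+ 2 = rnorm x ^+ 2 + rnorm y ^+ 2 + 2 * complex.Re (inner x y).
Proof.
have E (z : H) : rnorm z ^+ 2 = complex.Re (inner z z) by rewrite inner_rnorm.
rewrite !E (dnormD (@inner R H)) !raddfD /= mulr_natl mulr2n; congr (_ + (_ + _)).
by case: (inner x y).
Qed.

Lemma rnorm_le_inner H (x : H) (c : R) : 0 <= c ->
  (forall y, rnorm (inner y x) <= c * rnorm y) -> rnorm x <= c.
Proof.
move=> c0 /(_ x); rewrite inner_rnorm rnorm_real ger0_norm ?sqr_ge0 // expr2.
have [->//|x0] := eqVneq (rnorm x) 0.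
by rewrite ler_pM2r // lt_def x0 rnorm_ge0.
Qed.

Lemma le_of_sqr (a b : R) : 0 <= b -> a ^+ 2 <= b ^+ 2 -> a <= b.
Proof.
move=> b0 h; have [a0|a0] := leP a 0; first exact: le_trans a0 b0.
by rewrite -(@ler_pXn2r _ 2) // nnegrE ltW.
Qed.

Lemma geometric_small (q C e : R) : 0 <= q -> q < 1 -> 0 < e ->
  exists N, forall n, (N <= n)%N -> C * q ^+ n < e.
Proof.
move=> q0 q1 e0.
have cq : (fun n => C * q ^+ n) @ \oo --> (0 : R).
  rewrite -[X in _ --> X](mulr0 C); apply: cvgMl_tmp; apply: cvg_expr.
  by rewrite ger0_norm.
have [N _ hN] := cvgr_lt _ cq e e0.
by exists N => n Nn; exact: hN.
Qed.

Lemma geometric_le0 (q C a : R) : 0 <= q -> q < 1 ->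
  (forall n, a <= C * q ^+ n) -> a <= 0.
Proof.
move=> q0 q1 h; rewrite leNgt; apply/negP => a0.
have [N /(_ N (leqnn N))] := geometric_small C q0 q1 a0.
by rewrite ltNge h.
Qed.

Lemma geometric_sum_le (q : R) m n : 0 <= q -> q < 1 ->
  \sum_(m <= i < n) q ^+ i <= q ^+ m / (1 - q).
Proof.
move=> q0 q1; have q1' : 0 < 1 - q by rewrite subr_gt0.
rewrite ler_pdivlMr // big_distrl /=.
rewrite (eq_bigr (fun i => - (q ^+ i.+1 - q ^+ i))); last first.
  by move=> i _; rewrite exprS; ring.
have [nm|mn] := leqP n m; first by rewrite big_geq // exprn_ge0.
rewrite sumrN telescope_sumr ?(ltnW mn) // opprB.
by rewrite lerBlDr lerDl exprn_ge0.
Qed.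

(** A Cauchy sequence with a geometric rate; every limit in the proof is of this
    kind, and the explicit rate is what the later estimates use. *)
Lemma geometric_cvg (V : completeNormedModType R[i]) (u : nat -> V) (M q : R) :
  0 <= q -> q < 1 -> (forall n, rnorm (u n.+1 - u n) <= M * q ^+ n) ->
  exists l, forall n, rnorm (l - u n) <= M * q ^+ n / (1 - q).
Proof.
move=> q0 q1 hu; have q1' : 0 < 1 - q by rewrite subr_gt0.
have M0 : 0 <= M by have := le_trans (rnorm_ge0 _) (hu 0%N); rewrite expr0 mulr1.
have dist m n : (m <= n)%N -> rnorm (u n - u m) <= M * q ^+ m / (1 - q).
  move=> mn; rewrite -(telescope_sumr u mn).
  apply: le_trans (rnorm_sum _ _ _) _.
  apply: le_trans (_ : \sum_(m <= i < n) M * q ^+ i <= _).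
    exact: ler_sum.
  by rewrite -mulr_sumr -mulrA ler_wpM2l // geometric_sum_le.
have /cauchy_cvgP cu : cauchy (u @ \oo).
  apply/cauchy_exP => e e0.
  have eE : e = ((rnorm e)%:C)%C by rewrite rnormC gtr0_norm.
  have re0 : 0 < rnorm e by rewrite -ltcR -eE.
  have [N hN] := geometric_small (M / (1 - q)) q0 q1 re0.
  exists (u N); exists N => // n /= Nn.
  rewrite -ball_normE /= eE -rnormC ltcR rdistC.
  by apply: le_lt_trans (dist _ _ Nn) _; rewrite mulrAC; exact: hN.
exists (lim (u @ \oo)) => n.
apply/ler_addgt0Pr => e e0.
have e0' : (0 : R[i]) < (e%:C)%C by rewrite ltcR.
move/cvgrPdist_le : cu => /(_ _ e0') [N _ hN].
have /= := hN (maxn N n) (leq_maxl _ _); rewrite -rnormC lecR => h1.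
rewrite -[lim _](subrK (u (maxn N n))) -addrA addrC.
apply: le_trans (rnormD _ _) _.
by apply: lerD => //; apply: dist; exact: leq_maxr.
Qed.

End Norms.

(** * Riesz representation, adjoints and projections *)
Section Operators.
Variable R : realType.
Implicit Types (H K : hilbertType R) (V W : normedModType R[i]).

Lemma bop_bound V W (A : bop V W) :
  exists2 M, 0 < M & forall x, rnorm (A x) <= M * rnorm x.
Proof.
have /linear_boundedP/pinfty_ex_gt0[M M0 hM] : bounded_near A (nbhs 0).
  apply: continuous_linear_bounded; exact: (@bop_continuous _ _ _ A 0).
have ME : M = ((rnorm M)%:C)%C by rewrite rnormC gtr0_norm.
exists (rnorm M); first by rewrite -ltcR -ME.
by move=> x; rewrite -lecR rmorphM /= -ME !rnormC.
Qed.

Lemma bopP V W (f : V -> W) (M : R) : linear f ->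
  (forall x, rnorm (f x) <= M * rnorm x) -> exists T : bop V W, forall x, T x = f x.
Proof.
move=> lf hM.
pose fL := GRing.isLinear.Build R[i] V W _ f lf.
pose F : {linear V -> W} := HB.pack f fL.
have cF : continuous F.
  apply: bounded_linear_continuous; apply/linear_boundedP.
  exists ((Num.max M 0)%:C)%C; split.
    by apply/complex_realP; eexists.
  move=> r hr x; rewrite -!rnormC.
  apply: le_trans (_ : ((Num.max M 0)%:C)%C * ((rnorm x)%:C)%C <= _).
    rewrite -rmorphM /= lecR; apply: le_trans (hM x) _.
    by rewrite ler_wpM2r ?rnorm_ge0 // le_max lexx.
  by apply: ler_wpM2r; [rewrite rnormC normr_ge0|exact: ltW].
by exists (Bop cF).
Qed.

(** Minimising the energy [|A x|^2 - 2 Re (phi x)]: by the parallelogram law a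
    minimising sequence is Cauchy for [x |-> |A x|], hence for the norm, and
    the first variation vanishes at its limit. With [A] the identity this is the
    Riesz representation theorem; for general [A] it inverts [A^* A]. *)
Lemma energy_solution H K (A : bop H K) (phi : H -> R[i]) (c M : R) :
  0 <= c -> (forall x, rnorm x <= c * rnorm (A x)) ->
  linear_for *%R phi -> (forall x, rnorm (phi x) <= M * rnorm x) ->
  exists y, forall x, inner (A x) (A y) = phi x.
Proof.
move=> c0 hc lphi hM.
have phiD x y : phi (x + y) = phi x + phi y.
  by have := lphi 1 x y; rewrite scale1r mul1r.
have phi0 : phi 0 = 0.
  by have /eqP := phiD 0 0; rewrite addr0 -subr_eq0 opprD addrA subrr sub0r oppr_eq0 => /eqP.
have phiZ a x : phi (a *: x) = a * phi x by have := lphi a x 0; rewrite phi0 !addr0.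
have M0' : 0 <= `|M| by exact: normr_ge0.
have {}hM x : rnorm (phi x) <= `|M| * rnorm x.
  by apply: le_trans (hM x) _; rewrite ler_wpM2r ?rnorm_ge0 // ler_norm.
pose N x := rnorm (A x).
have N0 x : 0 <= N x by exact: rnorm_ge0.
pose J x := N x ^+ 2 - 2 * complex.Re (phi x).
have JD x w : J (x + w) = J x + N w ^+ 2 + 2 * complex.Re (inner (A x) (A w) - phi w).
  by rewrite /J /N linearD sqr_rnormD phiD !raddfD /= raddfN /=; ring.
have Jlb x : - (`|M| * c) ^+ 2 <= J x.
  have h1 : complex.Re (phi x) <= `|M| * c * N x.
    apply: le_trans (ler_norm _) _; apply: le_trans (rnorm_Re _) _.
    by apply: le_trans (hM x) _; rewrite -mulrA ler_wpM2l // hc.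
  rewrite /J; have := sqr_ge0 (N x - `|M| * c); nra.
have infJ : has_inf (range J).
  split; first by exists (J 0); exists 0.
  by exists (- (`|M| * c) ^+ 2) => _ [x _ <-].
pose m := inf (range J).
have mJ x : m <= J x by apply: ge_inf; [case: infJ|exists x].
pose q : R := 2^-1.
have q0 : 0 < q by rewrite invr_gt0.
have q1 : q < 1 by rewrite invf_lt1 // ltr1n.
have near_min n : exists x, J x < m + q ^+ (2 * n).
  have [|_ [x _ <-] hx] := @inf_adherent _ (range J) (q ^+ (2 * n)) _ infJ.
    by rewrite exprn_gt0.
  by exists x.
have [u hu] := choice near_min.
have u_step n : rnorm (u n.+1 - u n) <= 2 * c * q ^+ n.
  (* The midpoint [x + d] has energy at least [m], which bounds [N d]. *)
  set x := u n; set y := u n.+1; pose d := (2^-1 : R[i]) *: (y - x).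
  have e1 : y = (x + d) + d.
    rewrite -addrA -scalerDl (_ : 2^-1 + 2^-1 = 1 :> R[i]).
      by rewrite scale1r addrC subrK.
    by rewrite -mulr2n -[2^-1 *+ 2]mulr_natl mulfV // pnatr_eq0.
  have e2 : N (y - x) = 2 * N d.
    have -> : y - x = (2 : R[i]) *: d by rewrite /d scalerA mulfV ?scale1r // pnatr_eq0.
    by rewrite /N linearZ rnormZ rnorm_nat.
  have Jx := hu n; have Jy := hu n.+1; rewrite -/x in Jx; rewrite -/y in Jy.
  have Jm := mJ (x + d).
  have Jy' : J y = 2 * J (x + d) - J x + 2 * N d ^+ 2.
    have eI : inner (A (x + d)) (A d) = inner (A x) (A d) + ((N d ^+ 2)%:C)%C.
      by rewrite -inner_rnorm linearD linearDl.
    by rewrite e1 JD (JD x d) eI; move: (J x) => j; rewrite !raddfB !raddfD /=; ring.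
  have hq : q ^+ (2 * n.+1) <= q ^+ (2 * n).
    by apply: ler_wiXn2l; rewrite ?(ltW q0) ?(ltW q1) ?leq_mul2l ?leqnSn ?orbT.
  have Nd : N d ^+ 2 <= (q ^+ n) ^+ 2.
    by rewrite -exprM mulnC; nra.
  have {}Nd : N d <= q ^+ n.
    by rewrite -(@ler_pXn2r _ 2) ?nnegrE ?N0 ?(exprn_ge0 _ (ltW q0)).
  apply: le_trans (hc _) _; rewrite -/(N (y - x)) e2.
  by rewrite [2 * c]mulrC -mulrA ler_wpM2l // ler_pM2l.
have [y hy] := geometric_cvg (ltW q0) q1 u_step.
exists y => x; apply/eqP; rewrite -subr_eq0; apply/eqP; apply: rnorm_eq0.
have [a a0 ha] := bop_bound A.
pose k := N x ^+ 2 + 1.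
have k0 : 0 < k by rewrite ltr_wpDl ?sqr_ge0.
have var n : rnorm (inner (A x) (A (u n)) - phi x) <= k * q ^+ n.
  set de := inner (A x) (A (u n)) - phi x.
  pose t : R := k^-1.
  (* The direction of steepest descent of the energy at [u n] along [x]; the step
     [1/k] keeps the quadratic term below half of the linear gain. *)
  pose w := (- ((t%:C)%C * de^*)) *: x.
  have Jw := mJ (u n + w); have Ju := hu n.
  have Nw : N w ^+ 2 = t ^+ 2 * rnorm de ^+ 2 * N x ^+ 2.
    rewrite /N linearZ rnormZ rnormN rnormM rnorm_real rnormJ.
    by rewrite !exprMn real_normK // num_real.
  have Rw : complex.Re (inner (A (u n)) (A w) - phi w) = - t * rnorm de ^+ 2.
    have -> : complex.Re (inner (A (u n)) (A w) - phi w) =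
              complex.Re (inner (A w) (A (u n)) - phi w).
      by rewrite !raddfB /= innerC; case: (inner _ _).
    rewrite linearZ innerZl phiZ -mulrBr -/de mulNr -mulrA [_^* * _]mulrC -normCK.
    rewrite -rnormC -rmorphXn -rmorphM /= mulNr.
    by [].
  rewrite JD Nw Rw in Jw.
  have h1 : t * N x ^+ 2 <= 1.
    by rewrite mulrC ler_pdivrMr // mul1r lerDl.
  have t0 : 0 < t by rewrite invr_gt0.
  have h2 : t * rnorm de ^+ 2 <= q ^+ (2 * n).
    have h3 : 0 <= t * rnorm de ^+ 2 by rewrite mulr_ge0 ?sqr_ge0 ?ltW.
    have h4 : t ^+ 2 * rnorm de ^+ 2 * N x ^+ 2 <= t * rnorm de ^+ 2.
      have -> : t ^+ 2 * rnorm de ^+ 2 * N x ^+ 2 =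
                (t * N x ^+ 2) * (t * rnorm de ^+ 2) by ring.
      by rewrite ler_piMl.
    move: Jw Ju; lra.
  have h5 : rnorm de ^+ 2 <= k * q ^+ (2 * n).
    by rewrite -ler_pdivrMl.
  apply: le_of_sqr; first by rewrite mulr_ge0 ?exprn_ge0 // ltW.
  apply: le_trans h5 _; rewrite exprMn -exprM [(n * 2)%N]mulnC.
  rewrite ler_pM2r ?exprn_gt0 // expr2 ler_peMl ?(ltW k0) //.
  by rewrite lerDr sqr_ge0.
apply: (@geometric_le0 _ q (N x * (a * (2 * c / (1 - q))) + k)) => //; first exact: ltW.
move=> n.
have -> : inner (A x) (A y) - phi x =
    inner (A x) (A (y - u n)) + (inner (A x) (A (u n)) - phi x).
  by rewrite addrA -linearDr -linearD subrK.
apply: le_trans (rnormD _ _) _; rewrite mulrDl; apply: lerD => //.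
apply: le_trans (inner_CS _ _) _; rewrite -/(N x).
rewrite -[N x * _ * _]mulrA; apply: ler_wpM2l => //.
apply: le_trans (ha _) _; rewrite -[a * _ * _]mulrA ler_pM2l //.
by rewrite mulrAC; exact: hy.
Qed.

Lemma riesz H (phi : H -> R[i]) (M : R) :
  linear_for *%R phi -> (forall x, rnorm (phi x) <= M * rnorm x) ->
  exists y, forall x, inner x y = phi x.
Proof.
move=> lphi hM; apply: (@energy_solution _ _ (id_bop H) phi 1 M) => // x.
by rewrite mul1r.
Qed.

Lemma adjointE H K (A : bop H K) x y : inner (A x) y = inner x (adjoint A y).
Proof.
suff [B hB] : exists B : bop K H, forall x y, inner (A x) y = inner x (B y).
  rewrite /adjoint; have := @xgetPex _ (null_bop K H)
    [set B : bop K H | forall x y, inner (A x) y = inner x (B y)] (ex_intro _ B hB).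
  by apply.
have [a a0 ha] := bop_bound A.
have rep (z : K) : exists w, forall x, inner x w = inner (A x) z.
  apply: (@riesz _ _ (a * rnorm z)).
    by move=> k u v; rewrite linearP linearPl.
  move=> u; apply: le_trans (inner_CS _ _) _.
  by rewrite mulrAC ler_wpM2r ?rnorm_ge0.
have [B hB] := choice rep.
have [] := @bopP _ _ B a; last first.
- by move=> T hT; exists T => u v; rewrite hT hB.
- move=> z; apply: rnorm_le_inner; first by rewrite mulr_ge0 ?rnorm_ge0 ?ltW.
  move=> w; rewrite hB; apply: le_trans (inner_CS _ _) _.
  by rewrite mulrAC ler_wpM2r ?rnorm_ge0.
- move=> k u v; apply: inner_ext => w.
  by rewrite linearPr /= !hB linearPr.
Qed.

Lemma adjointEr H K (A : bop H K) x y : inner (adjoint A y) x = inner y (A x).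
Proof. by rewrite innerC -adjointE -innerC. Qed.

(** The adjoint of the inclusion of a closed subspace is the projection onto it. *)
Lemma orth_projE H K (A : bop H K) x (y : ker A) :
  inner (orth_proj A x) y = inner x (ker_val y).
Proof.
suff h : forall x (y : ker A), inner (x - ker_val (orth_proj A x)) (ker_val y) = 0.
  by have /eqP := h x y; rewrite linearBl subr_eq0 => /eqP ->.
pose P := adjoint (ker_incl A).
have := @xgetPex _ (null_bop H (ker A))
  [set P | forall x (y : ker A), inner (x - ker_val (P x)) (ker_val y) = 0].
rewrite -/(orth_proj A); apply; exists P => u v.
rewrite linearBl -[X in _ - X]/(inner (P u) v) /P adjointEr.
by rewrite -[ker_incl A v]/(ker_val v) subrr.
Qed.

(** Existence of the inverse is [energy_solution] for the functional [<., z>]. *)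
Lemma inv_gramE H (A : bop H H) (c : R) : 0 <= c ->
  (forall x, rnorm x <= c * rnorm (A x)) ->
  is_inverse (comp_bop (adjoint A) A) (inv_bop (comp_bop (adjoint A) A)).
Proof.
move=> c0 hc; rewrite /inv_bop.
have := @xgetPex _ (null_bop H H) (is_inverse (comp_bop (adjoint A) A)).
apply.
have sol (z : H) : exists w, forall x, inner (A x) (A w) = inner x z.
  apply: (@energy_solution _ _ _ _ c (rnorm z)) => //.
    by move=> k u v; rewrite linearPl.
  by move=> u; rewrite mulrC; exact: inner_CS.
have [B hB] := choice sol.
have inj u v : (forall x, inner (A x) (A u) = inner (A x) (A v)) -> u = v.
  move=> h; apply/eqP; rewrite -subr_eq0; apply/eqP; apply: rnorm_eq0.
  apply: le_trans (hc _) _.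
  have /eqP : inner (A (u - v)) (A (u - v)) = 0.
    by rewrite [X in inner _ X]linearB linearBr /= h subrr.
  by rewrite dnorm_eq0 => /eqP ->; rewrite rnorm0 mulr0.
have [] := @bopP _ _ B (c * c).
- move=> k u v; apply: inj => x.
  by rewrite hB [A (_ + _)]linearP !linearPr /= !hB.
- move=> z; rewrite -mulrA; apply: le_trans (hc _) _; apply: ler_wpM2l => //.
  have h : rnorm (A (B z)) ^+ 2 <= rnorm (A (B z)) * (c * rnorm z).
    have -> : rnorm (A (B z)) ^+ 2 = rnorm (inner (B z) z).
      by rewrite -hB inner_rnorm rnorm_real ger0_norm ?sqr_ge0.
    apply: le_trans (inner_CS _ _) _; rewrite mulrCA mulrA.
    by apply: ler_wpM2r; [exact: rnorm_ge0|exact: hc].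
  have := rnorm_ge0 (A (B z)); rewrite le_eqVlt => /predU1P[<-|p0].
    by rewrite mulr_ge0 ?rnorm_ge0.
  by move: h; rewrite expr2 ler_pM2l.
move=> T hT; exists T; split => [y|x] /=; rewrite hT.
  by apply: inj => x; rewrite hB adjointE.
by apply: inner_ext => x'; rewrite -adjointE hB.
Qed.

End Operators.

(** * Power series with coefficients in a Banach space *)
Section PowerSeries.
Variables (R : realType) (V : completeNormedModType R[i]).
Implicit Types (c d : nat -> V) (w z : R[i]) (M p : R).

Definition psum c w N : V := \sum_(n < N) w ^+ n *: c n.

(** Convergence at some geometric rate; leaving the rate free lets the sums of a
    series, of its shift and of linear combinations be compared through uniqueness
    alone. *)
Definition is_psum c w (l : V) :=
  exists C q, [/\ 0 <= q, q < 1 & forall N, rnorm (l - psum c w N) <= C * q ^+ N].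

Lemma is_psum_uniq c w l1 l2 : is_psum c w l1 -> is_psum c w l2 -> l1 = l2.
Proof.
move=> [C1 [q1 [q10 q11 h1]]] [C2 [q2 [q20 q21 h2]]].
apply/eqP; rewrite -subr_eq0; apply/eqP; apply: rnorm_eq0.
have C10 : 0 <= C1 by have := le_trans (rnorm_ge0 _) (h1 0%N); rewrite mulr1.
have C20 : 0 <= C2 by have := le_trans (rnorm_ge0 _) (h2 0%N); rewrite mulr1.
have q0 : 0 <= Num.max q1 q2 by rewrite le_max q10.
apply: (@geometric_le0 _ (Num.max q1 q2) (C1 + C2)) => //; first by rewrite gt_max q11.
move=> n; rewrite -(subrKA (psum c w n)) mulrDl.
apply: le_trans (rnormD _ _) _; apply: lerD.
  apply: le_trans (h1 n) _; apply: ler_wpM2l => //.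
  by apply: lerXn2r; rewrite ?nnegrE // le_max lexx.
rewrite rdistC; apply: le_trans (h2 n) _; apply: ler_wpM2l => //.
by apply: lerXn2r; rewrite ?nnegrE // le_max lexx orbT.
Qed.

Lemma is_psum_ex c w M p : 0 <= p -> p * rnorm w < 1 ->
  (forall n, rnorm (c n) <= M * p ^+ n) ->
  exists l, is_psum c w l /\
    forall N, rnorm (l - psum c w N) <= M * (p * rnorm w) ^+ N / (1 - p * rnorm w).
Proof.
move=> p0 pw hc.
have q0 : 0 <= p * rnorm w by rewrite mulr_ge0 ?rnorm_ge0.
have [|l hl] := geometric_cvg (u := psum c w) (M := M) q0 pw.
  move=> n; rewrite /psum big_ord_recr /= addrAC subrr add0r rnormZ rnormX.
  by rewrite exprMn mulrA mulrC ler_wpM2r ?exprn_ge0 ?rnorm_ge0.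
exists l; split => //; exists (M / (1 - p * rnorm w)), (p * rnorm w).
by split => // N; rewrite mulrAC; exact: hl.
Qed.

Lemma is_psum_rate c w l M p N : 0 <= p -> p * rnorm w < 1 ->
  (forall n, rnorm (c n) <= M * p ^+ n) -> is_psum c w l ->
  rnorm (l - psum c w N) <= M * (p * rnorm w) ^+ N / (1 - p * rnorm w).
Proof.
move=> p0 pw hc hl; have [l' [hl' h]] := is_psum_ex p0 pw hc.
by rewrite (is_psum_uniq hl hl').
Qed.

Lemma is_psum_bound c w l M p : 0 <= p -> p * rnorm w < 1 ->
  (forall n, rnorm (c n) <= M * p ^+ n) -> is_psum c w l ->
  rnorm l <= M / (1 - p * rnorm w).
Proof.
move=> p0 pw hc hl; have := is_psum_rate 0%N p0 pw hc hl.
by rewrite /psum big_ord0 subr0 mulr1.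
Qed.

Lemma is_psumP (a : R[i]) c d w l l' : is_psum c w l -> is_psum d w l' ->
  is_psum (fun n => a *: c n + d n) w (a *: l + l').
Proof.
move=> [C1 [q1 [q10 q11 h1]]] [C2 [q2 [q20 q21 h2]]].
have C10 : 0 <= C1 by have := le_trans (rnorm_ge0 _) (h1 0%N); rewrite mulr1.
have C20 : 0 <= C2 by have := le_trans (rnorm_ge0 _) (h2 0%N); rewrite mulr1.
have q0 : 0 <= Num.max q1 q2 by rewrite le_max q10.
exists (rnorm a * C1 + C2), (Num.max q1 q2); split => //; first by rewrite gt_max q11.
move=> N.
have -> : psum (fun n => a *: c n + d n) w N = a *: psum c w N + psum d w N.
  rewrite /psum scaler_sumr -big_split /=; apply: eq_bigr => i _.
  by rewrite scalerDr !scalerA mulrC.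
rewrite opprD addrACA -scalerBr mulrDl; apply: le_trans (rnormD _ _) _.
rewrite rnormZ -mulrA; apply: lerD.
  apply: ler_wpM2l; first exact: rnorm_ge0.
  apply: le_trans (h1 N) _; apply: ler_wpM2l => //.
  by apply: lerXn2r; rewrite ?nnegrE // le_max lexx.
apply: le_trans (h2 N) _; apply: ler_wpM2l => //.
by apply: lerXn2r; rewrite ?nnegrE // le_max lexx orbT.
Qed.

Lemma is_psum_shift c w l l' : is_psum c w l -> is_psum (fun n => c n.+1) w l' ->
  l = c 0%N + w *: l'.
Proof.
move=> hl [C [q [q0 q1 h]]]; apply: is_psum_uniq hl _.
have C0 : 0 <= C by have := le_trans (rnorm_ge0 _) (h 0%N); rewrite mulr1.
pose K := rnorm w * C + rnorm (c 0%N + w *: l').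
have [q'0 q'q q'1] : [/\ 0 < (q + 1) / 2, q <= (q + 1) / 2 & (q + 1) / 2 < 1].
  by split; lra.
set q' := (q + 1) / 2 in q'0 q'q q'1.
exists (K / q'), q'; split => //; first exact: ltW.
case=> [|N].
  rewrite /psum big_ord0 subr0 mulr1 ler_pdivlMr //.
  apply: le_trans (_ : rnorm (c 0%N + w *: l') <= _).
    by rewrite ler_piMr ?rnorm_ge0 // ltW.
  by rewrite lerDr mulr_ge0 ?rnorm_ge0.
have -> : psum c w N.+1 = c 0%N + w *: psum (fun n => c n.+1) w N.
  rewrite /psum big_ord_recl expr0 scale1r scaler_sumr; congr (_ + _).
  by apply: eq_bigr => i _; rewrite lift0 scalerA -exprS.
rewrite opprD addrACA subrr add0r -scalerBr rnormZ exprS.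
rewrite mulrA divfK ?gt_eqF // mulrDl.
apply: le_trans (_ : rnorm w * C * q' ^+ N <= _); last first.
  by rewrite lerDl mulr_ge0 ?rnorm_ge0 ?exprn_ge0 // ltW.
rewrite -mulrA; apply: ler_wpM2l; first exact: rnorm_ge0.
apply: le_trans (h N) _; apply: ler_wpM2l => //.
by apply: lerXn2r; rewrite ?nnegrE // ltW.
Qed.

(** Dividing [F w - F z] by [w - z]: the quotient is the power series in [w] whose
    [i]-th coefficient is the [i+1]-st remainder of the series at [z]. *)
Lemma psum_divide c (F : R[i] -> V) M p z : 0 <= p -> p * rnorm z < 1 ->
  (forall n, rnorm (c n) <= M * p ^+ n) ->
  (forall w, p * rnorm w < 1 -> is_psum c w (F w)) ->
  exists d M' (G : R[i] -> V),
    [/\ forall n, rnorm (d n) <= M' * p ^+ n,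
        forall w, p * rnorm w < 1 -> is_psum d w (G w) &
        forall w, p * rnorm w < 1 -> F w - F z = (w - z) *: G w].
Proof.
move=> p0 pz hc hF.
have tail i : forall n, rnorm (c (n + i)%N) <= M * p ^+ i * p ^+ n.
  by move=> n; rewrite -mulrA -exprD addnC.
(* [d i] is the sum of [z^n c_(n+i+1)]; hence [d i = c_(i+1) + z d_(i+1)]. *)
have [d hd] := choice (fun i => is_psum_ex p0 pz (tail i.+1)).
have dB n : rnorm (d n) <= M * p / (1 - p * rnorm z) * p ^+ n.
  have := is_psum_bound p0 pz (tail n.+1) (hd n).1.
  by rewrite exprS mulrA mulrAC.
have [G hG] : {G : R[i] -> V & forall w, p * rnorm w < 1 -> is_psum d w (G w)}.
  apply: (@choice _ _ (fun w l => p * rnorm w < 1 -> is_psum d w l)) => w.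
  have [pw|_] := boolP (p * rnorm w < 1); last by exists 0.
  by have [l [hl _]] := is_psum_ex p0 pw dB; exists l.
have dS i : d i = c i.+1 + z *: d i.+1.
  have := is_psum_shift (hd i).1; rewrite add0n; apply.
  have [+ _] := hd i.+1; congr is_psum; apply/funext => n.
  by rewrite addSnnS.
exists d, (M * p / (1 - p * rnorm z)), G; split => // w pw.
have dSB n : rnorm (d n.+1) <= M * p / (1 - p * rnorm z) * p * p ^+ n.
  by rewrite -mulrA -exprS.
have [G1 [hG1 _]] := is_psum_ex p0 pw dSB.
have GE := is_psum_shift (hG _ pw) hG1.
have FzE : F z = c 0%N + z *: d 0%N.
  apply: is_psum_shift (hF _ pz) _.
  have [+ _] := hd 0%N; congr is_psum; apply/funext => n.
  by rewrite addn1.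
have cE : (fun n => c n.+1) = (fun n => (- z) *: d n.+1 + d n).
  by apply/funext => n; rewrite [in X in _ + X]dS scaleNr addrCA addNr addr0.
have FwE : F w = c 0%N + w *: ((- z) *: G1 + G w).
  apply: is_psum_shift (hF _ pw) _; rewrite cE.
  exact: is_psumP hG1 (hG _ pw).
have zG : z *: G w = z *: d 0%N + (z * w) *: G1 by rewrite GE scalerDr scalerA.
rewrite FwE FzE opprD addrACA subrr add0r scalerBl zG scalerDr scalerA.
by rewrite mulrN scaleNr [w * z]mulrC opprD -addrA addrC  [RHS]addrA.
Qed.

(** By [psum_divide] the difference quotient at [z] is a power series [G]; applying
    the division once more to [G] bounds [G (z + h) - G z] by a multiple of [|h|]. *)
Lemma psum_derivable c (F : R[i] -> V) M p z : 0 <= p -> p * rnorm z < 1 ->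
  (forall n, rnorm (c n) <= M * p ^+ n) ->
  (forall w, p * rnorm w < 1 -> is_psum c w (F w)) ->
  forall F' : R[i] -> V, (forall w, p * rnorm w < 1 -> F' w = F w) ->
  derivable (F' : R[i]^o -> V) z 1.
Proof.
move=> p0 pz hc hF F' FF'.
have [d [M' [G [hd hG FG]]]] := psum_divide p0 pz hc hF.
have [d2 [M2 [G2 [hd2 hG2 GG2]]]] := psum_divide p0 pz hd hG.
(* So small that [p |z + h|] stays below the midpoint of [p |z|] and 1. *)
pose delta : R := (1 - p * rnorm z) / (2 * (p + 1)).
have p1 : 0 < p + 1 by rewrite ltr_wpDl.
have d0 : 0 < delta by rewrite divr_gt0 ?subr_gt0 ?mulr_gt0.
have nearz h : rnorm h <= delta -> p * rnorm (z + h) <= (1 + p * rnorm z) / 2.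
  move=> hd'; apply: le_trans (_ : p * (rnorm z + delta) <= _).
    by apply: ler_wpM2l => //; apply: le_trans (rnormD _ _) _; rewrite lerD2l.
  have : p * delta <= (1 - p * rnorm z) / 2.
    have -> : p * delta = (1 - p * rnorm z) / 2 * (p / (p + 1)).
      by rewrite /delta; field; rewrite gt_eqF.
    apply: ler_piMr; first by rewrite divr_ge0 // subr_ge0 ltW.
    by rewrite ler_pdivrMr // mul1r lerDl.
  by rewrite mulrDr; lra.
have mid : (1 + p * rnorm z) / 2 < 1 by lra.
pose K := M2 / (1 - (1 + p * rnorm z) / 2).
have M20 : 0 <= M2 by have := le_trans (rnorm_ge0 _) (hd2 0%N); rewrite mulr1.
have near_G h : rnorm h <= delta -> rnorm (G (z + h) - G z) <= rnorm h * K.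
  move=> hd'; have le := nearz _ hd'; have lt := le_lt_trans le mid.
  rewrite GG2 // addrC addKr rnormZ; apply: ler_wpM2l; first exact: rnorm_ge0.
  apply: le_trans (is_psum_bound p0 lt hd2 (hG2 _ lt)) _.
  rewrite ler_pdivrMr ?subr_gt0 // /K mulrAC ler_pdivlMr ?subr_gt0 //.
  by apply: ler_wpM2l => //; rewrite lerB.
apply/cvg_ex; exists (G z); apply/cvgrPdist_le => e e0.
have eE : e = ((rnorm e)%:C)%C by rewrite rnormC gtr0_norm.
have re0 : 0 < rnorm e by rewrite -ltcR -eE.
have K0 : 0 <= K by rewrite divr_ge0 // subr_ge0 ltW.
pose eta := Num.min delta (rnorm e / (K + 1)).
have K1 : 0 < K + 1 by rewrite ltr_wpDl.
have eta0 : 0 < eta by rewrite lt_min d0 divr_gt0.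
exists ((eta%:C)%C); first by rewrite /= ltcR.
move=> h /=; rewrite sub0r normrN -rnormC ltcR => hlt hn0.
have hd' : rnorm h <= delta by apply: ltW (lt_le_trans hlt _); rewrite ge_min lexx.
have lt := le_lt_trans (nearz _ hd') mid.
rewrite eE -rnormC lecR.
have -> : h^-1 *: (F' (h *: (1 : R[i]^o) + z) - F' z) = G (z + h).
  have -> : h *: (1 : R[i]^o) + z = z + h by rewrite addrC /GRing.scale /= mulr1.
  by rewrite !FF' // FG // addrC addKr scalerA mulVf ?scale1r.
rewrite rdistC; apply: le_trans (near_G _ hd') _.
apply: le_trans (_ : rnorm e / (K + 1) * K <= _).
  apply: ler_wpM2r => //; apply: ltW (lt_le_trans hlt _).
  by rewrite ge_min lexx orbT.
by rewrite mulrAC ler_pdivrMr // ler_wpM2l ?rnorm_ge0 // lerDl.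
Qed.

End PowerSeries.

(** * Left-invertible operators and their Cauchy duals *)
Section LeftInvertible.
Variables (R : realType) (H : hilbertType R) (A : bop H H).
Hypothesis A_linv : left_invertible A.

Local Notation A' := (cauchy_dual A).
Local Notation L := (adjoint A').
Local Notation E := (ker (adjoint A)).
Local Notation P := (orth_proj (adjoint A)).

Lemma left_invertible_lb : exists2 c : R, 0 < c & forall x, rnorm x <= c * rnorm (A x).
Proof.
have [B AK] := A_linv; have [c c0 hc] := bop_bound B.
by exists c => // x; rewrite -{1}(AK x).
Qed.

Lemma gramK : is_inverse (comp_bop (adjoint A) A) (inv_bop (comp_bop (adjoint A) A)).
Proof. by have [c c0 hc] := left_invertible_lb; exact: inv_gramE (ltW c0) hc. Qed.

Lemma adjoint_dualK x : adjoint A (A' x) = x.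
Proof. exact: (gramK.2 x). Qed.

Lemma dual_gram x : A' (adjoint A (A x)) = A x.
Proof. by congr (A _); exact: (gramK.1 x). Qed.

Lemma inner_dual x y : inner (A' x) (A y) = inner x y.
Proof. by rewrite -adjointEr adjoint_dualK. Qed.

Lemma dualK x : L (A x) = x.
Proof. by apply: inner_ext => y; rewrite -adjointE inner_dual. Qed.

Lemma kerP (g : E) : adjoint A (ker_val g) = 0.
Proof. by apply/eqP; exact: (ker_valP g). Qed.

Lemma dual_ker (g : E) : L (ker_val g) = 0.
Proof.
apply: inner_ext => y; rewrite -adjointE linear0r.
by rewrite /cauchy_dual /= adjointE kerP linear0r.
Qed.

Lemma orth_proj_range x : P (A x) = 0.
Proof.
by apply: inner_ext => y; rewrite innerC orth_projE adjointE kerP linear0r conjC0 linear0r.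
Qed.

Lemma orth_proj_ker (g : E) : P (ker_val g) = g.
Proof. by apply: inner_ext => y; rewrite innerC orth_projE -innerC. Qed.

(** [x - A (L x)] is in [ker A^*] because [A' (A^* A) = A], and [P] kills the range of
    [A]. *)
Lemma orth_proj_split x : x = ker_val (P x) + A (L x).
Proof.
have k : x - A (L x) \in @ker_pred _ _ _ (adjoint A).
  apply/eqP; apply: inner_ext => y; rewrite linear0r -adjointE linearBr /=.
  rewrite -[inner (A y) (A _)]adjointEr -adjointE dual_gram.
  by rewrite subrr.
have e : x = ker_val (Ker k) + A (L x) by rewrite /= subrK.
rewrite [in LHS]e; congr (_ + _).
by rewrite [in RHS]e linearD orth_proj_range addr0 orth_proj_ker.
Qed.

Lemma pow_bopS (B : bop H H) n x : pow_bop B n.+1 x = B (pow_bop B n x).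
Proof. by []. Qed.

Lemma pow_bopSr (B : bop H H) n x : pow_bop B n.+1 x = pow_bop B n (B x).
Proof. by elim: n x => [//|n IH] x; rewrite pow_bopS IH -pow_bopS. Qed.

Lemma pow_adjointE (B : bop H H) n x y :
  inner (pow_bop B n x) y = inner x (pow_bop (adjoint B) n y).
Proof.
by elim: n y => [//|n IH] y; rewrite pow_bopS adjointE IH -pow_bopSr.
Qed.

(** Iteration of [orth_proj_split] on [x], [L x], [L^2 x] and so on. *)
Lemma wold_expansion N x :
  x = \sum_(n < N) pow_bop A n (ker_val (P (pow_bop L n x))) + pow_bop A N (pow_bop L N x).
Proof.
elim: N => [|N IH]; first by rewrite big_ord0 add0r.
rewrite big_ord_recr -addrA {1}IH; congr (_ + _).
by rewrite [pow_bop A N.+1 _]pow_bopSr -linearD [pow_bop L N.+1 _]pow_bopS -orth_proj_split.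
Qed.

(** [A^*] is a bounded left inverse of [A']. *)
Lemma dual_pow_lb : exists2 c : R, 0 < c &
  forall n x, rnorm x <= c ^+ n * rnorm (pow_bop A' n x).
Proof.
have [c c0 hc] := bop_bound (adjoint A); exists c => // n x.
elim: n => [|n IH]; first by rewrite mul1r.
apply: le_trans IH _; rewrite exprSr -mulrA ler_wpM2l ?exprn_ge0 ?(ltW c0) //.
by rewrite -{1}[pow_bop A' n x]adjoint_dualK; exact: hc.
Qed.

End LeftInvertible.

(** * Double sums over squares of indices *)
Section SquareSums.
Variables (R : realType) (V : normedModType R[i]).

Definition square (N : nat) : seq (nat * nat) :=
  [seq (j, k) | j <- iota 0 N, k <- iota 0 N].

Lemma mem_square N (i : nat * nat) : (i \in square N) = (i.1 < N)%N && (i.2 < N)%N.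
Proof.
case: i => j k; apply/allpairsP/andP => /= [[[a b] /= [+ + [-> ->]]]|[jN kN]].
  by rewrite !mem_iota.
by exists (j, k); rewrite !mem_iota.
Qed.

Lemma uniq_square N : uniq (square N).
Proof. by apply: allpairs_uniq; rewrite ?iota_uniq // => -[a b] [c d]. Qed.

Lemma big_square (W : zmodType) (F : nat * nat -> W) N :
  \sum_(i <- square N) F i = \sum_(j < N) \sum_(k < N) F (j : nat, k : nat).
Proof.
rewrite /square big_allpairs -(big_mkord xpredT (fun j => \sum_(k < N) F (j, k : nat))).
rewrite /index_iota subn0; apply: eq_bigr => j _.
by rewrite -(big_mkord xpredT (fun k => F (j, k))) /index_iota subn0.
Qed.

Lemma big_square_sub (W : zmodType) (F : nat * nat -> W) (s : seq (nat * nat)) N :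
  uniq s -> (forall i, i \in s -> i \in square N) ->
  \sum_(i <- square N) F i = \sum_(i <- s) F i + \sum_(i <- square N | i \notin s) F i.
Proof.
move=> us sN; rewrite (bigID (mem s)) /=; congr (_ + _).
rewrite -big_filter; apply: perm_big; apply: uniq_perm => //.
  by rewrite filter_uniq // uniq_square.
by move=> i; rewrite mem_filter; apply: andb_idr; exact: sN.
Qed.

(** Only the indices outside the small square contribute, and with [g n] the partial
    sums of [q^j] their total is [K (g N ^2 - g N0 ^2)]. *)
Lemma square_tail (G : nat * nat -> V) (K q : R) N0 N (s : seq (nat * nat)) :
  0 <= K -> 0 <= q -> q < 1 ->
  (forall i, rnorm (G i) <= K * (q ^+ i.1 * q ^+ i.2)) -> (N0 <= N)%N ->
  uniq s -> (forall i, i \in s -> i \in square N) ->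
  (forall i, i \in square N0 -> i \notin s -> G i = 0) ->
  rnorm (\sum_(i <- square N) G i - \sum_(i <- s) G i) <=
    2 * K / (1 - q) ^+ 2 * q ^+ N0.
Proof.
move=> K0 q0 q1 hG N0N us sN h0.
have q1' : 0 < 1 - q by rewrite subr_gt0.
rewrite (big_square_sub G us sN) addrAC subrr add0r.
apply: le_trans (rnorm_sum _ _ _) _.
pose B (i : nat * nat) := K * (q ^+ i.1 * q ^+ i.2).
have B0 i : 0 <= B i by rewrite !mulr_ge0 ?exprn_ge0.
apply: le_trans (_ : \sum_(i <- square N | i \notin square N0) B i <= _).
  rewrite big_mkcond [X in _ <= X]big_mkcond /=; apply: ler_sum => i _.
  have [iN0|iN0] := boolP (i \in square N0) => /=; last by case: ifP.
  by case: ifP => // /(h0 _ iN0) ->; rewrite rnorm0.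
have sub i : i \in square N0 -> i \in square N.
  by rewrite !mem_square => /andP[h1 h2]; rewrite !(leq_trans _ N0N).
have := big_square_sub B (uniq_square N0) sub => /eqP.
rewrite addrC -subr_eq => /eqP <-.
pose g n : R := \sum_(0 <= j < n) q ^+ j.
have sqB n : \sum_(i <- square n) B i = K * g n ^+ 2.
  rewrite big_square expr2 /g big_mkord mulr_suml mulr_sumr; apply: eq_bigr => j _.
  by rewrite !mulr_sumr; apply: eq_bigr => k _.
rewrite !sqB.
have gN n : g n <= (1 - q)^-1.
  by have := @geometric_sum_le _ q 0 n q0 q1; rewrite expr0 div1r.
have g0 n : 0 <= g n by apply: sumr_ge0 => j _; rewrite exprn_ge0.
have dg : g N - g N0 <= q ^+ N0 / (1 - q).
  have -> : g N - g N0 = \sum_(N0 <= j < N) q ^+ j.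
    by rewrite /g (@big_cat_nat _ _ _ N0) //= addrAC subrr add0r.
  exact: geometric_sum_le.
have -> : K * g N ^+ 2 - K * g N0 ^+ 2 = K * ((g N - g N0) * (g N + g N0)) by ring.
have -> : 2 * K / (1 - q) ^+ 2 * q ^+ N0 =
    K * ((q ^+ N0 / (1 - q)) * ((1 - q)^-1 + (1 - q)^-1)).
  by field; rewrite gt_eqF.
apply: ler_wpM2l => //; apply: le_trans (_ : (q ^+ N0 / (1 - q)) * (g N + g N0) <= _).
  by apply: ler_wpM2r => //; rewrite addr_ge0.
by apply: ler_wpM2l; [rewrite divr_ge0 ?exprn_ge0 // ltW|exact: lerD].
Qed.

End SquareSums.

(** * The analytic model of a left-invertible operator *)
Section Model.
Variables (R : realType) (H : hilbertType R) (A : bop H H).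
Hypothesis A_linv : left_invertible A.

Local Notation A' := (cauchy_dual A).
Local Notation L := (adjoint A').
Local Notation E := (ker (adjoint A)).
Local Notation P := (orth_proj (adjoint A)).

Definition growth (M p : R) := [/\ 0 <= M, 0 <= p &
  forall n (g : E), rnorm (pow_bop A' n (ker_val g)) <= M * p ^+ n * rnorm g].

Definition summable_at (w : R[i]) := exists M p, growth M p /\ p * rnorm w < 1.

(** The [n]-th Taylor coefficient at 0 of the function that represents [f]. *)
Definition model_coef (f : H) (n : nat) : E := P (pow_bop L n f).

(** By duality: [<P L^n f, g> = <f, A'^n g>] for [g] in [ker A^*]. *)
Lemma model_coef_bound M p f n : growth M p -> rnorm (model_coef f n) <= M * p ^+ n * rnorm f.
Proof.
move=> [M0 p0 hg]; apply: (@rnorm_le_inner _ E).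
  by rewrite !mulr_ge0 ?rnorm_ge0 ?exprn_ge0.
move=> g; rewrite innerC rnormJ orth_projE innerC rnormJ -pow_adjointE.
apply: le_trans (inner_CS _ _) _.
by rewrite mulrAC; apply: ler_wpM2r; [exact: rnorm_ge0|exact: hg].
Qed.

Lemma model_coef_bound' M p f : growth M p ->
  forall n, rnorm (model_coef f n) <= M * rnorm f * p ^+ n.
Proof. by move=> hg n; rewrite mulrAC; exact: model_coef_bound. Qed.

Lemma model_coefP a f g n : model_coef (a *: f + g) n = a *: model_coef f n + model_coef g n.
Proof. by rewrite /model_coef !linearP. Qed.

Lemma model_coefS f n : model_coef f n.+1 = model_coef (L f) n.
Proof. by rewrite /model_coef pow_bopSr. Qed.

Lemma model_eval_ex w : exists T : bop H E,
  summable_at w -> forall f, is_psum (model_coef f) w (T f).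
Proof.
have [[M [p [gr pw]]]|ng] := pselect (summable_at w); last by exists (null_bop H E).
have p0 : 0 <= p by case: gr.
have ex f := is_psum_ex p0 pw (model_coef_bound' f gr).
have [T hT] := choice ex.
have [] := @bopP _ _ _ T (M / (1 - p * rnorm w)).
- move=> a f g; apply: is_psum_uniq (hT _).1 _.
  rewrite (_ : model_coef _ = fun n => a *: model_coef f n + model_coef g n).
    exact: is_psumP (hT f).1 (hT g).1.
  by apply/funext => n; rewrite model_coefP.
- move=> f; rewrite mulrAC.
  exact: is_psum_bound p0 pw (model_coef_bound' f gr) (hT f).1.
by move=> T' hT'; exists T' => _ f; rewrite hT'; exact: (hT f).1.
Qed.

(** The value at [w] of the function that represents [f], for all [f] at once; where the
    series need not converge it is an arbitrary bounded operator. *)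
Definition model_eval : R[i] -> bop H E := projT1 (choice model_eval_ex).

Lemma model_evalP w f : summable_at w -> is_psum (model_coef f) w (model_eval w f).
Proof. by move=> sw; exact: (projT2 (choice model_eval_ex) w sw f). Qed.

Lemma model_eval_bound w f M p : growth M p -> p * rnorm w < 1 ->
  rnorm (model_eval w f) <= M / (1 - p * rnorm w) * rnorm f.
Proof.
move=> gr pw; have p0 : 0 <= p by case: gr.
have := is_psum_bound p0 pw (model_coef_bound' f gr)
  (model_evalP f (ex_intro _ M (ex_intro _ p (conj gr pw)))).
by rewrite mulrAC.
Qed.

Lemma model_eval_split w f : summable_at w -> model_eval w f = P f + w *: model_eval w (L f).
Proof.
move=> sw; apply: is_psum_shift (model_evalP _ sw) _.
rewrite (_ : (fun n => model_coef f n.+1) = model_coef (L f)); first exact: model_evalP.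
by apply/funext => n; rewrite model_coefS.
Qed.

Lemma model_eval_ker w (g : E) : summable_at w -> model_eval w (ker_val g) = g.
Proof.
by move=> sw; rewrite model_eval_split // orth_proj_ker dual_ker linear0 scaler0 addr0.
Qed.

Lemma model_eval_op w f : summable_at w -> model_eval w (A f) = w *: model_eval w f.
Proof. by move=> sw; rewrite model_eval_split // orth_proj_range // dualK // add0r. Qed.

Lemma model_eval_pow w n f : summable_at w -> model_eval w (pow_bop A n f) = w ^+ n *: model_eval w f.
Proof.
move=> sw; elim: n => [|n IH]; first by rewrite scale1r.
by rewrite pow_bopS model_eval_op // IH scalerA exprS.
Qed.

Lemma model_eval_derivable w : summable_at w -> forall f,
  derivable (fun z : R[i]^o => model_eval z f) w 1.
Proof.
move=> [M [p [gr pw]]] f; have p0 : 0 <= p by case: gr.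
apply: (psum_derivable p0 pw (model_coef_bound' f gr) (F := fun z => model_eval z f)) => //.
by move=> z pz; apply: model_evalP; exists M, p.
Qed.

(** Identity theorem, from [model_eval w f = P f + w model_eval w (L f)]: if
    [model_eval w f] vanishes for small [w != 0] then [P f = 0] by letting [w] tend to 0,
    whence [model_eval w (L f)] vanishes for the same [w]. *)
Lemma model_eval_coef0 f (M p delta : R) : growth M p -> 0 < delta ->
  (forall w, w != 0 -> rnorm w < delta -> model_eval w f = 0) -> forall n, model_coef f n = 0.
Proof.
move=> gr d0 h n; have [M0 p0 _] := gr.
pose eps := Num.min delta (2 * (p + 1))^-1.
have p1 : 0 < p + 1 by rewrite ltr_wpDl.
have eps0 : 0 < eps by rewrite lt_min d0 invr_gt0 mulr_gt0.
have small (w : R[i]) : rnorm w < eps -> p * rnorm w <= 2^-1.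
  rewrite lt_min => /andP[_ w1]; apply: le_trans (_ : (p + 1) * (2 * (p + 1))^-1 <= _).
    by apply: ler_pM => //; rewrite ?rnorm_ge0 ?lerDl // ltW.
  by rewrite invfM mulrCA mulfV ?mulr1 // gt_eqF.
have half : 2^-1 < 1 :> R by rewrite invf_lt1 // ltr1n.
have sm (w : R[i]) : rnorm w < eps -> summable_at w.
  by move=> w1; exists M, p; exact: (conj gr (le_lt_trans (small _ w1) half)).
have {}h w : w != 0 -> rnorm w < eps -> model_eval w f = 0.
  by move=> w0; rewrite lt_min => /andP[w1 _]; exact: h.
have step g : (forall w, w != 0 -> rnorm w < eps -> model_eval w g = 0) -> P g = 0.
  move=> hg; apply: rnorm_eq0.
  have h2 : (0 : R) <= 2^-1 by rewrite invr_ge0.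
  apply: (@geometric_le0 _ 2^-1 (eps / 2 * (M / (1 - 2^-1) * rnorm (L g)))) => // k.
  pose w : R[i] := ((eps / 2 * 2^-1 ^+ k)%:C)%C.
  have w0' : 0 < eps / 2 * 2^-1 ^+ k by rewrite mulr_gt0 ?divr_gt0 // exprn_gt0 // invr_gt0.
  have rw : rnorm w = eps / 2 * 2^-1 ^+ k by rewrite rnorm_real gtr0_norm.
  have we : rnorm w < eps.
    rewrite rw; apply: le_lt_trans (_ : eps / 2 < _); last by lra.
    by rewrite ler_piMr ?divr_ge0 ?(ltW eps0) // exprn_ile1 // ltW.
  have w0 : w != 0.
    by apply/eqP => w0; have := rnorm0 R[i]; rewrite -w0 rw => e0; rewrite e0 ltxx in w0'.
  have := model_eval_split g (sm _ we); rewrite hg // => /esym/eqP.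
  rewrite addr_eq0 => /eqP ->; rewrite rnormN rnormZ rw mulrAC ler_wpM2r ?exprn_ge0 //.
  apply: ler_wpM2l; first by rewrite divr_ge0 // ltW.
  apply: le_trans (model_eval_bound _ gr (le_lt_trans (small _ we) half)) _.
  apply: ler_wpM2r; first exact: rnorm_ge0.
  apply: ler_wpM2l => //; rewrite lef_pV2 ?posrE ?subr_gt0 //.
    by rewrite lerB // small.
  exact: le_lt_trans (small _ we) half.
elim: n f h => [|n IH] f h; first exact: step.
rewrite model_coefS; apply: IH => w w0 we.
have := model_eval_split f (sm _ we); rewrite h // step // add0r => /esym/eqP.
by rewrite scaler_eq0 (negbTE w0) => /eqP.
Qed.

Section Kernel.
Variables (z w : R[i]) (M p M' p' : R).
Hypotheses (gr : growth M p) (pz : p * rnorm z < 1).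
Hypotheses (gr' : growth M' p') (pw : p' * rnorm w < 1).

Let sz : summable_at z. Proof. by exists M, p. Qed.
Let sw : summable_at w. Proof. by exists M', p'. Qed.

Definition kernel_term (i : nat * nat) (g : E) : E :=
  (z ^+ i.1 * w^* ^+ i.2) *: P (pow_bop L i.1 (pow_bop A' i.2 (ker_val g))).

Lemma kernel_term_bound i g :
  rnorm (kernel_term i g) <= M * M' * rnorm g * ((p * rnorm z) ^+ i.1 * (p' * rnorm w) ^+ i.2).
Proof.
have [M0 p0 _] := gr; have [M0' p0' hg] := gr'.
rewrite rnormZ rnormM !rnormX rnormJ !exprMn.
apply: le_trans (_ : rnorm z ^+ i.1 * rnorm w ^+ i.2 *
    (M * p ^+ i.1 * (M' * p' ^+ i.2 * rnorm g)) <= _).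
  apply: ler_wpM2l; first by rewrite mulr_ge0 ?exprn_ge0 ?rnorm_ge0.
  apply: le_trans (model_coef_bound _ _ gr) _; apply: ler_wpM2l; last exact: hg.
  by rewrite mulr_ge0 ?exprn_ge0.
by rewrite le_eqVlt; apply/orP; left; apply/eqP; ring.
Qed.

(** Partial sums of the expansion of the kernel vector at [w]: the adjoint of the [N]-th
    partial sum of [model_eval w]. *)
Definition kernel_partial (N : nat) (g : E) : H :=
  \sum_(k < N) (w^* ^+ k) *: pow_bop A' k (ker_val g).

Lemma kernel_partial_inner N f g : inner (psum (model_coef f) w N) g = inner f (kernel_partial N g).
Proof.
rewrite /psum /kernel_partial linear_sumlz linear_sumr; apply: eq_bigr => k _.
rewrite linearZl_LR [in RHS]linearZr_LR /= rmorphXn /= conjCK; congr (_ * _).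
by rewrite orth_projE innerC -pow_adjointE -innerC.
Qed.

(** An operator and its adjoint have the same norm, so the rate is that of the partial
    sums of [model_eval w]. *)
Lemma kernel_partial_rate N g : rnorm (adjoint (model_eval w) g - kernel_partial N g) <=
  M' / (1 - p' * rnorm w) * (p' * rnorm w) ^+ N * rnorm g.
Proof.
have [M0' p0' hg] := gr'.
have q1 : 0 < 1 - p' * rnorm w by rewrite subr_gt0.
have q0 : 0 <= p' * rnorm w by rewrite mulr_ge0 ?rnorm_ge0.
apply: rnorm_le_inner.
  by rewrite !mulr_ge0 ?rnorm_ge0 ?exprn_ge0 ?invr_ge0 // ltW.
move=> f; rewrite linearBr /= -adjointE -kernel_partial_inner -linearBl.
apply: le_trans (inner_CS _ _) _.
rewrite -mulrA [rnorm g * _]mulrC mulrA; apply: ler_wpM2r; first exact: rnorm_ge0.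
apply: le_trans (is_psum_rate N p0' pw (model_coef_bound' f gr') (model_evalP f sw)) _.
by rewrite le_eqVlt; apply/orP; left; apply/eqP; ring.
Qed.

Lemma kernel_partial_bound N g : rnorm (kernel_partial N g) <= M' / (1 - p' * rnorm w) * rnorm g.
Proof.
have [M0' p0' hg] := gr'.
have q1 : 0 < 1 - p' * rnorm w by rewrite subr_gt0.
have q0 : 0 <= p' * rnorm w by rewrite mulr_ge0 ?rnorm_ge0.
apply: le_trans (rnorm_sum _ _ _) _.
apply: le_trans (_ : \sum_(k < N) M' * rnorm g * (p' * rnorm w) ^+ k <= _).
  apply: ler_sum => k _; rewrite rnormZ rnormX rnormJ exprMn.
  rewrite mulrA [X in _ <= X]mulrC; apply: ler_wpM2l; first by rewrite exprn_ge0 ?rnorm_ge0.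
  by rewrite mulrAC; exact: hg.
rewrite -mulr_sumr -(big_mkord xpredT (fun k => (p' * rnorm w) ^+ k)).
apply: le_trans (_ : M' * rnorm g * (1 - p' * rnorm w)^-1 <= _).
  apply: ler_wpM2l; first by rewrite mulr_ge0 ?rnorm_ge0.
  by have := geometric_sum_le 0 N q0 pw; rewrite div1r.
by rewrite mulrAC.
Qed.

Lemma kernel_partial_psum N g :
  psum (model_coef (kernel_partial N g)) z N = \sum_(i <- square N) kernel_term i g.
Proof.
rewrite big_square /psum; apply: eq_bigr => j _.
rewrite /model_coef /kernel_partial [pow_bop L _ _]linear_sum [P _]linear_sum.
rewrite scaler_sumr; apply: eq_bigr => k _.
by rewrite [pow_bop L _ _]linearZ [P _]linearZ scalerA.
Qed.

Lemma kernel_rate : exists C q, [/\ 0 <= C, 0 <= q, q < 1 & forall N g,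
  rnorm (model_eval z (adjoint (model_eval w) g) - \sum_(i <- square N) kernel_term i g)
    <= C * q ^+ N * rnorm g].
Proof.
have [M0 p0 _] := gr; have [M0' p0' hg] := gr'.
set a := p * rnorm z; set b := p' * rnorm w.
have a0 : 0 <= a by rewrite mulr_ge0 ?rnorm_ge0.
have b0 : 0 <= b by rewrite mulr_ge0 ?rnorm_ge0.
have a1 : 0 < 1 - a by rewrite subr_gt0.
have b1 : 0 < 1 - b by rewrite subr_gt0.
pose q := Num.max a b.
have q0 : 0 <= q by rewrite le_max a0.
have aq : a <= q by rewrite le_max lexx.
have bq : b <= q by rewrite le_max lexx orbT.
pose C := M / (1 - a) * (M' / (1 - b)).
have C0 : 0 <= C by rewrite !mulr_ge0 ?invr_ge0 // ltW.
exists (C + C), q; split => //; first exact: addr_ge0.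
  by rewrite gt_max pz pw.
move=> N g.
rewrite -kernel_partial_psum -(subrKA (model_eval z (kernel_partial N g))) !mulrDl.
rewrite -[model_eval z (adjoint _ _) - _]linearB.
apply: le_trans (rnormD _ _) _; apply: lerD.
  apply: le_trans (model_eval_bound _ gr pz) _; rewrite -/a /C -!mulrA.
  apply: ler_wpM2l => //; apply: ler_wpM2l; first by rewrite invr_ge0 ltW.
  apply: le_trans (kernel_partial_rate _ _) _; rewrite -/b -!mulrA.
  apply: ler_wpM2l => //; apply: ler_wpM2l; first by rewrite invr_ge0 ltW.
  by apply: ler_wpM2r; [exact: rnorm_ge0|apply: lerXn2r].
have := is_psum_rate N p0 pz (model_coef_bound' (kernel_partial N g) gr)
  (model_evalP (kernel_partial N g) sz).
move/le_trans; apply; rewrite -/a.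
apply: le_trans (_ : M * (M' / (1 - b) * rnorm g) * q ^+ N / (1 - a) <= _).
  apply: ler_wpM2r; first by rewrite invr_ge0 ltW.
  apply: ler_pM; rewrite ?mulr_ge0 ?rnorm_ge0 ?exprn_ge0 //.
    by apply: ler_wpM2l => //; exact: kernel_partial_bound.
  exact: lerXn2r.
by rewrite le_eqVlt; apply/orP; left; apply/eqP; rewrite /C; ring.
Qed.

Lemma kernel_term00 g : kernel_term (0%N, 0%N) g = g.
Proof. by rewrite /kernel_term !expr0 mul1r scale1r /= orth_proj_ker. Qed.

Lemma kernel_term0r j g : kernel_term (j.+1, 0%N) g = 0.
Proof.
by rewrite /kernel_term pow_bopSr dual_ker ?linear0 ?scaler0.
Qed.

Lemma kernel_term0l k g : kernel_term (0%N, k.+1) g = 0.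
Proof. by rewrite /kernel_term /= orth_proj_range ?scaler0. Qed.

(** Outside the band only the term [(0, 0)] survives, and it is the identity. Compare
    the sum over a finite [J] with the sum over a square containing [J]: the tail
    estimate [square_tail] does not depend on that square, so the square may then grow
    to infinity. *)
Lemma kernel_opnorm_sum (b : nat) :
  (forall j k (g : E), ~~ ((j <= k + b) && (k <= j + b))%N ->
     P (pow_bop L j (pow_bop A' k (ker_val g))) = 0) ->
  opnorm_sum (band b) kernel_term (fun g => model_eval z (adjoint (model_eval w) g) - g).
Proof.
move=> hband eps eps0.
have [M0 p0 _] := gr; have [M0' p0' hg] := gr'.
have [C [q1 [C0 q10 q11 hC]]] := kernel_rate.
pose a := p * rnorm z; pose c := p' * rnorm w.
have a0 : 0 <= a by rewrite mulr_ge0 ?rnorm_ge0.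
have c0 : 0 <= c by rewrite mulr_ge0 ?rnorm_ge0.
pose q := Num.max a c.
have q0 : 0 <= q by rewrite le_max a0.
have q1' : q < 1 by rewrite gt_max pz pw.
pose K := 2 * (M * M') / (1 - q) ^+ 2.
have [N0 hN0] := geometric_small K q0 q1' eps0.
exists [fset i in [seq i <- square N0 | `[< band b i >]]]%fset; split.
  by move=> i /=; rewrite !inE mem_filter => /andP[/asboolP].
move=> J J0J JD g.
(* The term that gives the identity is removed, as in the statement. *)
pose G i := if i == (0%N, 0%N) then 0 else kernel_term i g.
have JG : \sum_(i <- enum_fset J) kernel_term i g = \sum_(i <- enum_fset J) G i.
  apply: eq_big_seq => i iJ; rewrite /G; case: eqP => // i0.
  by have := JD i iJ; rewrite i0 => -[].
have sqG N : \sum_(i <- square N.+1) kernel_term i g = g + \sum_(i <- square N.+1) G i.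
  have in0 : (0%N, 0%N) \in square N.+1 by rewrite mem_square.
  rewrite !(bigD1_seq _ in0 (uniq_square _)) /= kernel_term00.
  rewrite (_ : G (0%N, 0%N) = 0) ?add0r; last by rewrite /G eqxx.
  by congr (_ + _); apply: eq_bigr => i /negbTE i0; rewrite /G i0.
have [N1 hN1] : exists N1, forall i, i \in enum_fset J -> i \in square N1.
  exists (\max_(i <- enum_fset J) (maxn i.1 i.2).+1)%N => i iJ.
  by rewrite mem_square -gtn_max; exact: (@leq_bigmax_seq _ _ xpredT (fun i => (maxn i.1 i.2).+1)).
have tail N : (N0 <= N)%N -> (N1 <= N)%N ->
    rnorm (\sum_(i <- square N) G i - \sum_(i <- enum_fset J) G i) <= eps * rnorm g.
  move=> N0N N1N.
  have := @square_tail _ _ G (M * M' * rnorm g) q N0 N (enum_fset J).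
  move=> st; apply: le_trans (st _ _ _ _ _ _ _ _) _ => //.
  - by rewrite !mulr_ge0 ?rnorm_ge0.
  - move=> i; rewrite /G; case: eqP => [_|_].
      by rewrite rnorm0 !mulr_ge0 ?rnorm_ge0 ?exprn_ge0.
    apply: le_trans (kernel_term_bound _ _) _; apply: ler_wpM2l.
      by rewrite !mulr_ge0 ?rnorm_ge0.
    apply: ler_pM; rewrite ?exprn_ge0 //; apply: lerXn2r => //;
      by rewrite le_max lexx ?orbT.
  - exact: fset_uniq.
  - move=> i /hN1; rewrite !mem_square => /andP[h1 h2].
    by rewrite !(leq_trans _ N1N).
  - case=> j k jk; rewrite /G; case: eqP => // n0 nJ.
    have [bd|nb] := pselect (band b (j, k)).
      case/negP: nJ; apply: J0J => /=.
      by rewrite !inE mem_filter jk andbT; apply/asboolP.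
    case: j k {jk nJ} n0 nb => [|j] [|k] // n0 nb; rewrite ?kernel_term0l ?kernel_term0r //.
    rewrite /kernel_term hband ?scaler0 //; apply/negP => /andP[h1 h2].
    by apply: nb.
  - have := hN0 _ (leqnn N0); rewrite /K => /ltW hle.
    apply: le_trans (_ : 2 * (M * M') / (1 - q) ^+ 2 * q ^+ N0 * rnorm g <= _).
      by rewrite le_eqVlt; apply/orP; left; apply/eqP; ring.
    by apply: ler_wpM2r => //; exact: rnorm_ge0.
rewrite JG -subr_le0.
apply: (@geometric_le0 _ q1 (C * rnorm g * q1 ^+ (maxn N0 N1).+1)) => // k.
set N := (k + maxn N0 N1)%N.
have kN : (maxn N0 N1 <= N.+1)%N by rewrite leqW // leq_addl.
have h1 := hC N.+1 g; rewrite sqG in h1.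
have h2 := tail N.+1 (leq_trans (leq_maxl _ _) kN) (leq_trans (leq_maxr _ _) kN).
rewrite lerBlDr.
have -> : model_eval z (adjoint (model_eval w) g) - g - \sum_(i <- enum_fset J) G i =
  (model_eval z (adjoint (model_eval w) g) - (g + \sum_(i <- square N.+1) G i)) +
  (\sum_(i <- square N.+1) G i - \sum_(i <- enum_fset J) G i).
  by rewrite opprD !addrA subrK.
apply: le_trans (rnormD _ _) _; apply: lerD => //.
apply: le_trans h1 _; rewrite /N -addnS exprD.
by rewrite le_eqVlt; apply/orP; left; apply/eqP; ring.
Qed.

End Kernel.

End Model.

(** * Levels of a rooted directed tree *)
Section RootedTrees.
Variables (V : choiceType) (e : rel V) (root : V).
Hypotheses (e_tree : directed_tree e) (root_root : is_root e root).

Local Notation depth := (depth e root).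

Lemma parent_uniq u u' v : e u v -> e u' v -> u = u'.
Proof.
move=> uv u'v; have [|w [_ uw]] := @tree_parent _ _ e_tree v.
  by move=> /(_ u); rewrite uv.
by rewrite -(uw _ uv) (uw _ u'v).
Qed.

Lemma parE u v : e u v -> par e v = u.
Proof. by move=> uv; apply: xget_unique => // y yv; exact: parent_uniq yv uv. Qed.

Lemma edge_par v : ~ is_root e v -> e (par e v) v.
Proof.
move=> nr; have [u [uv _]] := @tree_parent _ _ e_tree v nr.
by rewrite (parE uv).
Qed.

Lemma nonroot u v : e u v -> ~ is_root e v.
Proof. by move=> uv /(_ u); rewrite uv. Qed.

(** Along an undirected walk from the root the level increases or decreases by
    one, and it cannot decrease at the root, which has no parent. *)
Lemma reachable v : exists n, Chin e n [set root] v.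
Proof.
have [->|rv] := eqVneq v root; first by exists 0%N.
suff walk p a : (exists n, Chin e n [set root] a) ->
    path (fun a b => e a b || e b a) a p -> exists n, Chin e n [set root] (last a p).
  rewrite eq_sym in rv; have [p [pp <-]] := tree_connected e_tree rv.
  by apply: walk pp; exists 0%N.
elim: p a => [//|b p IH] a [n an] /= /andP[ab pp].
apply: IH pp; case/orP: ab => ab; first by exists n.+1; exists a.
case: n an => [ar|n [u un ua]]; last by exists n; rewrite (parent_uniq ab ua).
by have := root_root b; rewrite -ar ab.
Qed.

Lemma level_uniq n m v : Chin e n [set root] v -> Chin e m [set root] v -> n = m.
Proof.
elim: n m v => [|n IH] [|m] v //.
- by move=> -> [u _ ur]; have := root_root u; rewrite ur.
- by move=> [u _ uv] vr; have := root_root u; rewrite -vr uv.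
- move=> [u nu uv] [u' mu' u'v]; congr _.+1; apply: IH nu _.
  by rewrite (parent_uniq uv u'v).
Qed.

Lemma level_depth v : Chin e (depth v) [set root] v.
Proof.
have [n nv] := reachable v.
exact: (@xgetPex _ 0%N [set n | Chin e n [set root] v]) (ex_intro _ n nv).
Qed.

Lemma level_depthE n v : Chin e n [set root] v -> depth v = n.
Proof. by apply: level_uniq; exact: level_depth. Qed.

Lemma depth_root : depth root = 0%N.
Proof. exact: level_depthE. Qed.

Lemma depth_edge u v : e u v -> depth v = (depth u).+1.
Proof. by move=> uv; apply: level_depthE; exists u => //; exact: level_depth. Qed.

Lemma depth_par v : ~ is_root e v -> depth v = (depth (par e v)).+1.
Proof. by move=> /edge_par/depth_edge. Qed.

Lemma root_depth0 v : is_root e v -> depth v = 0%N.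
Proof.
move=> rv; have := level_depth v; case: (depth v) => [//|n] [u _ uv].
by have := rv u; rewrite uv.
Qed.

Lemma depth_nonroot v : (0 < depth v)%N -> ~ is_root e v.
Proof. by move=> dv /root_depth0 d0; rewrite d0 in dv. Qed.

Lemma depth_iter_par n v : (n <= depth v)%N ->
  depth (iter n (par e) v) = (depth v - n)%N.
Proof.
elim: n => [|n IH] nv; first by rewrite subn0.
have dn := IH (ltnW nv).
have /depth_par : ~ is_root e (iter n (par e) v).
  by apply: depth_nonroot; rewrite dn subn_gt0.
by rewrite dn iterS subnS => ->.
Qed.

Lemma branching_depth (R : realType) (k : nat) u v w :
  branching_index e R root = (k%:R : R)%:E ->
  v != w -> e u v -> e u w -> (depth u < k)%N.
Proof.
move=> + vw uv uw; rewrite /branching_index.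
have bu : branching_vertices e u by exists v, w.
case: asboolP => [b0|_]; first by rewrite b0 in bu.
move=> kE; rewrite -(ltr_nat R) -lte_fin -kE.
apply: (@lt_le_trans _ _ (1 + (depth u)%:R%:E)%E).
  by rewrite -EFinD lte_fin ltrDr.
by apply: leeD2l; apply: ereal_sup_ubound; exists u.
Qed.

End RootedTrees.

(** * Square-summable functions *)
Section SquareSummable.
Variables (R : realType) (V : choiceType).
Local Notation L2 := (l2 R V).
Local Notation b_ := (@l2_basis R V).

Lemma rsum_single (u : V -> R) v : (forall w, w != v -> u w = 0) -> rsum u = u v.
Proof.
move=> hu.
have single (w : V -> R) : (forall i, 0 <= w i) -> (forall i, i != v -> w i = 0) ->
    (\esum_(i in [set: V]) (w i)%:E)%E = (w v)%:E.
  move=> w0 wv; transitivity (\esum_(i in [set v]) (w i)%:E)%E; last by rewrite esum_set1 ?lee_fin.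
  rewrite [RHS]esum_mkcond; apply: eq_esum => i _; rewrite in_set1.
  by case: eqVneq => [->//|/wv ->].
have m0 (x : R) : 0 <= Num.max x 0 by rewrite le_max lexx orbT.
rewrite /rsum (single (fun i => Num.max (u i) 0)) //; last first.
  by move=> i /hu ->; rewrite maxxx.
rewrite (single (fun i => Num.max (- u i) 0)) //=; last first.
  by move=> i /hu ->; rewrite oppr0 maxxx.
have [h|h] := leP (u v) 0; first by rewrite max_l ?oppr_ge0 // opprK add0r.
by rewrite max_r ?oppr_le0 ?subr0 // ltW.
Qed.

Lemma realC_neq0 (a : R) : 0 < a -> (a%:C)%C != 0 :> R[i].
Proof. by move=> a0; rewrite eq_complex /= gt_eqF. Qed.

Lemma realC_conj (a : R) : ((a%:C)%C : R[i])^* = (a%:C)%C.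
Proof. exact: conjc_real. Qed.

Lemma inner_basis (f : L2) v : inner f (b_ v) = f v.
Proof.
rewrite -[LHS]/(csum (fun w => f w * (b_ v w)^*)) /csum /=.
have h w : w != v -> f w * ((w == v)%:R)^* = 0 :> R[i].
  by move=> /negbTE ->; rewrite conjC0 mulr0.
rewrite (@rsum_single _ v); last by move=> w /h ->.
rewrite (@rsum_single _ v); last by move=> w /h ->.
by rewrite eqxx conjC1 mulr1; case: (f v).
Qed.

Lemma inner_disjoint (f g : L2) : (forall v, f v = 0 \/ g v = 0) -> inner f g = 0.
Proof.
move=> h; rewrite -[LHS]/(csum (fun w => f w * (g w)^*)).
rewrite (_ : (fun w => _) = (fun=> 0)).
  by rewrite /csum /rsum /= oppr0 maxxx esum1 // subrr.
by apply/funext => v; have [->|->] := h v; rewrite ?mul0r // conjC0 mulr0.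
Qed.

Lemma l2_subE (f g : L2) v : (f - g) v = f v - g v. Proof. by []. Qed.

Lemma l2_basisE u v : b_ u v = (v == u)%:R :> R[i]. Proof. by []. Qed.

Lemma inner_basis2 u v : inner (b_ u) (b_ v) = (u == v)%:R.
Proof. by rewrite inner_basis l2_basisE eq_sym. Qed.

Lemma rnorm_basis v : rnorm (b_ v) = 1.
Proof.
have := inner_rnorm (b_ v); rewrite inner_basis2 eqxx => /eqP.
rewrite eq_complex /= => /andP[/eqP h _].
by apply/eqP; rewrite -(@pexpr_eq1 _ _ 2) ?rnorm_ge0 // -h.
Qed.

Lemma rnorm_l2_le (f g : L2) (c : R) : 0 <= c ->
  (forall v, rnorm (f v) <= c * rnorm (g v)) -> rnorm f <= c * rnorm g.
Proof.
move=> c0 h; apply: le_of_sqr; first by rewrite mulr_ge0 ?rnorm_ge0.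
rewrite exprMn -lee_fin [(c ^+ 2 * _)%:E]EFinM !l2_sqnorm /sqnorm -esumZ ?sqr_ge0 //; last first.
  by move=> v; rewrite sqr_ge0.
apply: le_esum => v _; rewrite lee_fin -exprMn.
by apply: lerXn2r; rewrite ?nnegrE ?mulr_ge0 ?rnorm_ge0.
Qed.

(** The partial sum [g] over [s] satisfies [<f, g> = <g, g>], so [|f - g|^2] is the
    tail of the series [|f|^2]. *)
Lemma finite_support_dense (f : L2) (eps : R) : 0 < eps -> exists s : seq V,
  rnorm (f - \sum_(v <- s) f v *: b_ v) < eps.
Proof.
move=> eps0; have e20 : 0 < eps ^+ 2 by rewrite exprn_gt0.
have fin : sqnorm f \is a fin_num by rewrite -l2_sqnorm.
have [_ [X [finX _] <-]] := ub_ereal_sup_adherent e20 fin.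
rewrite -[X in (X - _)%E]/(sqnorm f) -l2_sqnorm fsbig_finite //= sumEFin -EFinB lte_fin.
set s := enum_fset _ => hs; exists s.
have us : uniq s by exact: fset_uniq.
pose g := \sum_(v <- s) f v *: b_ v; rewrite -/g.
have fv v : (((rnorm (f v) ^+ 2)%:C)%C : R[i]) = f v * (f v)^*.
  by rewrite rmorphXn /= rnormC normCK.
have inner_g h : inner h g = \sum_(v <- s) h v * (f v)^*.
  rewrite /g linear_sumr; apply: eq_bigr => v _.
  by rewrite linearZr_LR /= inner_basis mulrC.
have gE v : v \in s -> g v = f v.
  move=> vs; rewrite -(inner_basis g v) /g linear_sumlz (bigD1_seq v) //=.
  rewrite linearZl_LR /= inner_basis2 eqxx mulr1 big1 ?addr0 // => w wv.
  by rewrite linearZl_LR /= inner_basis2 (negbTE wv) mulr0.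
have fg : inner f g = ((\sum_(v <- s) rnorm (f v) ^+ 2)%:C)%C.
  by rewrite inner_g rmorph_sum /=; apply: eq_bigr => v _; rewrite fv.
have gg : inner g g = ((\sum_(v <- s) rnorm (f v) ^+ 2)%:C)%C.
  rewrite -fg !inner_g; apply: eq_big_seq => v vs.
  by rewrite gE.
have key : rnorm (f - g) ^+ 2 = rnorm f ^+ 2 - \sum_(v <- s) rnorm (f v) ^+ 2.
  have e : rnorm g ^+ 2 = \sum_(v <- s) rnorm (f v) ^+ 2.
    by apply: complexI; rewrite -gg inner_rnorm.
  have fNg : complex.Re (inner f (- g)) = - \sum_(v <- s) rnorm (f v) ^+ 2.
    by rewrite innerNr fg.
  by rewrite sqr_rnormD rnormN fNg e; ring.
rewrite -(@ltr_pXn2r _ 2) ?nnegrE ?rnorm_ge0 ?(ltW eps0) // key.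
by move: hs; lra.
Qed.

End SquareSummable.

(** * The root test for the radius of convergence *)
Section RootTest.
Variable R : realType.
Implicit Types (a : nat -> R) (s t : R).

(** This is [x^(-1/n)], infinite at [x = 0], in the form in which it occurs in
    [convergence_radius], where the square of [x] is the given quantity. *)
Definition root_term (x : R) n : \bar R := (((x ^+ 2)%:E `^ (2 * n%:R)^-1)^-1)%E.

Lemma root_termE x n : 0 <= x -> (0 < n)%N ->
  exists2 y : R, 0 <= y /\ y ^+ n = x & root_term x n = (y%:E^-1)%E.
Proof.
move=> x0 n0; exists ((x ^+ 2) `^ (2 * n%:R)^-1)%R; last by [].
split; first exact: powR_ge0.
apply/eqP; rewrite -(@eqrXn2 _ 2) ?exprn_ge0 ?powR_ge0 // -exprM mulnC.
rewrite -powR_mulrn ?powR_ge0 // -powRrM natrM mulVf ?powRr1 ?sqr_ge0 //.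
by rewrite mulf_neq0 // pnatr_eq0 // -lt0n.
Qed.

Lemma root_term_ge x n s : 0 <= x -> (0 < n)%N -> 0 < s ->
  (s%:E <= root_term x n)%E = (x * s ^+ n <= 1).
Proof.
move=> x0 n0 s0; have [y [y0 <-] ->] := root_termE x0 n0.
rewrite inver; case: eqVneq => [->|yn0].
  by rewrite expr0n -leqn0 leqNgt n0 mul0r ler01 leey.
have y0' : 0 < y by rewrite lt_def yn0.
rewrite lee_fin -exprMn expr_le1 ?mulr_ge0 ?(ltW s0) //.
by rewrite -[in RHS]ler_pdivlMl // mulr1.
Qed.

Lemma root_term_le x n s : 0 <= x -> (0 < n)%N -> 0 < s ->
  (root_term x n <= s%:E)%E = (1 <= x * s ^+ n).
Proof.
move=> x0 n0 s0; have [y [y0 <-] ->] := root_termE x0 n0.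
rewrite inver; case: eqVneq => [->|yn0].
  by rewrite expr0n -leqn0 leqNgt n0 mul0r ler10 leye_eq.
have y0' : 0 < y by rewrite lt_def yn0.
rewrite lee_fin -exprMn expr_ge1 ?mulr_ge0 ?(ltW s0) //.
by rewrite -[in RHS]ler_pdivrMl // mulr1.
Qed.

Lemma limn_einfE u : limn_einf u = ereal_sup (range (einfs u)) :> \bar R.
Proof. by rewrite limn_einf_lim; apply/cvg_lim => //; exact: cvg_einfs_sup. Qed.

Lemma lt_limn_einf (u : nat -> \bar R) x : (x < limn_einf u)%E ->
  exists N, forall n, (N <= n)%N -> (x < u n)%E.
Proof.
rewrite limn_einfE => /ereal_sup_gt[_ [N _ <-] xN]; exists N => n Nn.
by apply: lt_le_trans xN _; apply: ereal_inf_lbound; exists n.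
Qed.

Lemma limn_einf_ge (u : nat -> \bar R) x N : (forall n, (N <= n)%N -> (x <= u n)%E) ->
  (x <= limn_einf u)%E.
Proof.
move=> h; rewrite limn_einfE; apply: le_trans (ereal_sup_ubound _); last by exists N.
by apply: le_ereal_inf_tmp => _ [n /= Nn <-]; exact: h.
Qed.

Lemma limn_einf_le (u : nat -> \bar R) x N : (forall n, (N <= n)%N -> (u n <= x)%E) ->
  (limn_einf u <= x)%E.
Proof.
move=> h; rewrite limn_einfE; apply: ge_ereal_sup => _ [n _ <-].
apply: le_trans (h (maxn n N) (leq_maxr _ _)).
by apply: ereal_inf_lbound; exists (maxn n N) => //=; exact: leq_maxl.
Qed.

Definition root_liminf a : \bar R := limn_einf (fun n => root_term (a n) n).

(** The bound holds with constant 1 from some index on; [M] absorbs the finitely many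
    terms before it. *)
Lemma root_liminf_gt a s : (forall n, 0 <= a n) -> 0 < s -> (s%:E < root_liminf a)%E ->
  exists2 M, 0 <= M & forall n, a n <= M * s^-1 ^+ n.
Proof.
move=> a0 s0 /lt_limn_einf[N hN].
pose M := \sum_(n < N.+1) a n * s ^+ n + 1.
have M1 : 0 <= \sum_(n < N.+1) a n * s ^+ n.
  by apply: sumr_ge0 => n _; rewrite mulr_ge0 ?exprn_ge0 // ltW.
exists M => [|n]; first by rewrite addr_ge0.
rewrite exprVn ler_pdivlMr ?exprn_gt0 //.
have [Nn|nN] := ltnP N n.
  apply: le_trans (_ : 1 <= _); last by rewrite lerDr.
  by rewrite -root_term_ge // ?(leq_ltn_trans _ Nn) //; apply: ltW; apply: hN; exact: ltnW.
have nN' : (n < N.+1)%N by [].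
rewrite /M (bigD1 (Ordinal nN')) //= -addrA lerDl addr_ge0 //.
by apply: sumr_ge0 => i _; rewrite mulr_ge0 ?exprn_ge0 // ltW.
Qed.

Lemma root_liminf_ge a t C : (forall n, 0 <= a n) -> 0 < t ->
  (forall n, a n <= C * t ^+ n) -> (t^-1%:E <= root_liminf a)%E.
Proof.
move=> a0 t0 h.
have below s : 0 < s -> s < t^-1 -> (s%:E <= root_liminf a)%E.
  move=> s0 st; have q1 : t * s < 1 by rewrite -ltr_pdivlMl // mulr1.
  have q0 : 0 <= t * s by rewrite mulr_ge0 // ltW.
  have [N hN] := geometric_small C q0 q1 ltr01.
  apply: (@limn_einf_ge _ _ N.+1) => n Nn.
  rewrite root_term_ge // ?(leq_trans _ Nn) //.
  apply: le_trans (_ : C * t ^+ n * s ^+ n <= _).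
    by apply: ler_wpM2r => //; rewrite exprn_ge0 // ltW.
  by rewrite -mulrA -exprMn ltW // hN // ltnW.
have ti : 0 < t^-1 by rewrite invr_gt0.
apply/lee_subgt0Pr => eps eps0.
have [h1|h1] := ltP eps (t^-1).
  by rewrite -EFinB; apply: below; rewrite ?subr_gt0 // ltrBlDr ltrDl.
apply: le_trans (below (t^-1 / 2) _ _); rewrite ?divr_gt0 //; last by lra.
by rewrite -EFinB lee_fin; lra.
Qed.

Lemma root_liminf_le a c : (forall n, 0 <= a n) -> 0 < c ->
  (forall n, 1 <= a n * c ^+ n) -> (root_liminf a <= c%:E)%E.
Proof.
move=> a0 c0 h; apply: (@limn_einf_le _ _ 1) => n n0.
by rewrite root_term_le.
Qed.

End RootTest.

(** * Weighted shifts on rooted trees *)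
Section WeightedShift.
Variables (R : realType) (V : choiceType) (e : rel V) (root : V) (kT : nat).
Variables (lam : V -> R) (S : bop (l2 R V) (l2 R V)).
Hypotheses (e_tree : directed_tree e) (root_root : is_root e root).
Hypothesis kT_index : branching_index e R root = (kT%:R : R)%:E.
Hypothesis S_shift : is_weighted_shift e lam S.
Hypothesis S_linv : left_invertible S.

Local Notation b_ := (@l2_basis R V).
Local Notation depth := (depth e root).
Local Notation par := (par e).
Local Notation mu := (dual_weight e lam S).
Local Notation S' := (cauchy_dual S).
Local Notation L := (adjoint S').
Local Notation E := (ker (adjoint S)).
Local Notation P := (orth_proj (adjoint S)).

Implicit Types (f : l2 R V) (u v : V).

Lemma shift_root f v : is_root e v -> S f v = 0.
Proof. by move=> rv; rewrite S_shift.2 /wshift; case: asboolP. Qed.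

Lemma shift_nonroot f v : ~ is_root e v -> S f v = ((lam v)%:C)%C * f (par v).
Proof. by move=> rv; rewrite S_shift.2 /wshift; case: asboolP. Qed.

Lemma shift_vanish f v : f (par v) = 0 -> S f v = 0.
Proof.
by move=> f0; have [/shift_root ->//|/shift_nonroot ->] := pselect (is_root e v); rewrite f0 mulr0.
Qed.

Lemma shift_basis_vanish u v : ~~ e u v -> S (b_ u) v = 0.
Proof.
move=> nuv; have [/shift_root ->//|nr] := pselect (is_root e v).
apply: shift_vanish; rewrite l2_basisE; case: eqVneq => // pu.
by have := edge_par e_tree nr; rewrite pu (negbTE nuv).
Qed.

Lemma shift_basis_gt0 u : 0 < rnorm (S (b_ u)).
Proof.
have [c c0 /(_ (b_ u))] := left_invertible_lb S_linv; rewrite rnorm_basis => h.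
by rewrite -(pmulr_rgt0 _ c0); exact: lt_le_trans ltr01 h.
Qed.

(** [S f - f(u) S e_u] vanishes on the children of [u], which carry [S e_u]. *)
Lemma inner_shift_basis f u :
  inner (S f) (S (b_ u)) = ((rnorm (S (b_ u)) ^+ 2)%:C)%C * f u.
Proof.
have d0 : inner (S (f - f u *: b_ u)) (S (b_ u)) = 0.
  apply: inner_disjoint => v; have [uv|/shift_basis_vanish] := boolP (e u v); last by right.
  left; apply: shift_vanish; rewrite (parE e_tree uv).
  by rewrite l2_subE l2_scaleE l2_basisE eqxx mulr1 subrr.
rewrite -[f in LHS](subrK (f u *: b_ u)) linearD linearDl /= d0 add0r.
by rewrite linearZ linearZl_LR /= inner_rnorm mulrC.
Qed.

Lemma gram_shift f u :
  adjoint S (S f) u = ((rnorm (S (b_ u)) ^+ 2)%:C)%C * f u.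
Proof. by rewrite -inner_basis adjointEr inner_shift_basis. Qed.

Lemma dual_root f v : is_root e v -> S' f v = 0.
Proof. exact: shift_root. Qed.

Lemma dual_nonroot f v : ~ is_root e v -> S' f v = ((mu v)%:C)%C * f (par v).
Proof.
move=> nr; rewrite [LHS]shift_nonroot //.
set h := inv_bop _ f.
have fE : f = adjoint S (S h) by rewrite -[LHS](adjoint_dualK S_linv).
have nz : ((rnorm (S (b_ (par v))) ^+ 2)%:C)%C != 0 :> R[i].
  by apply: realC_neq0; rewrite exprn_gt0 // shift_basis_gt0.
rewrite [in RHS]fE gram_shift mulrA -rmorphM /= divfK //.
by rewrite gt_eqF // exprn_gt0 // shift_basis_gt0.
Qed.

Lemma dual_weight_gt0 v : ~ is_root e v -> 0 < mu v.
Proof.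
by move=> nr; rewrite divr_gt0 ?exprn_gt0 ?shift_basis_gt0 // S_shift.1.
Qed.

Definition weight_prod (n : nat) (v : V) : R := \prod_(i < n) mu (iter i par v).

Lemma weight_prodS n v : weight_prod n.+1 v = mu v * weight_prod n (par v).
Proof.
rewrite /weight_prod big_ord_recl; congr (_ * _).
by apply: eq_bigr => i _; rewrite lift0 iterSr.
Qed.

Lemma weight_prod_gt0 n v : (n <= depth v)%N -> 0 < weight_prod n v.
Proof.
move=> nv; apply: prodr_gt0 => i _; apply: dual_weight_gt0.
apply: (depth_nonroot e_tree root_root).
by rewrite (depth_iter_par e_tree root_root) ?subn_gt0 (leq_trans _ nv) // ltnW.
Qed.

Lemma dual_pow_shallow n f v : (depth v < n)%N -> pow_bop S' n f v = 0.
Proof.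
elim: n v => [//|n IH] v dv.
rewrite pow_bopS; have [/dual_root ->//|nr] := pselect (is_root e v).
rewrite dual_nonroot // IH ?mulr0 //.
by rewrite (depth_par e_tree root_root nr) in dv.
Qed.

Lemma dual_pow_deep n f v : (n <= depth v)%N ->
  pow_bop S' n f v = ((weight_prod n v)%:C)%C * f (iter n par v).
Proof.
elim: n v => [|n IH] v dv; first by rewrite /weight_prod big_ord0 mul1r.
have nr : ~ is_root e v by apply: (depth_nonroot e_tree root_root); exact: leq_trans dv.
rewrite pow_bopS dual_nonroot // IH; last by rewrite (depth_par e_tree root_root nr) in dv.
by rewrite mulrA -rmorphM -weight_prodS iterSr.
Qed.

Lemma pow_shift_shallow n f v : (depth v < n)%N -> pow_bop S n f v = 0.
Proof.
elim: n v => [//|n IH] v dv.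
rewrite pow_bopS; have [/shift_root ->//|nr] := pselect (is_root e v).
apply: shift_vanish; apply: IH.
by rewrite (depth_par e_tree root_root nr) in dv.
Qed.

(** Below the last branching level, [S e_u] is a multiple of a basis vector, so an
    element of [ker S^*] vanishes at the only child of [u]. *)
Lemma ker_deep (g : E) v : (kT < depth v)%N -> ker_val g v = 0.
Proof.
move=> dv; have nr := depth_nonroot e_tree root_root (leq_ltn_trans (leq0n _) dv).
have uv := edge_par e_tree nr; set u := par v in uv.
have Su : S (b_ u) = ((lam v)%:C)%C *: b_ v.
  apply: l2_ext => w; rewrite l2_scaleE l2_basisE; have [->|wv] := eqVneq w v.
    by rewrite shift_nonroot // l2_basisE eqxx.
  rewrite shift_basis_vanish ?mulr0 //; apply/negP => uw.
  have := branching_depth kT_index wv uw uv.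
  by rewrite ltnNge -ltnS -(depth_edge e_tree root_root uv) dv.
have := adjointE S (b_ u) (ker_val g); rewrite kerP linear0r Su linearZl_LR /= => /eqP.
rewrite mulf_eq0 => /orP[/eqP/complexI l0|/eqP].
  by have := S_shift.1 _ nr; rewrite l0 ltxx.
by rewrite innerC inner_basis => /eqP; rewrite conjC_eq0 => /eqP.
Qed.

Section TopLevels.
Hypothesis radius_fin : (radius_sum e mu root kT 1 < +oo)%E.

Let first_band v : R[i] :=
  if (0 < depth v <= kT.+1)%N then ((mu v)%:C)%C else 0.

Lemma level_bandE n v :
  level_band e root kT n v <-> (n <= depth v <= kT + n)%N.
Proof.
split; first by move=> [j jn jv]; rewrite (level_depthE e_tree root_root jv).
by move=> dv; exists (depth v) => //; exact: level_depth e_tree root_root v.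
Qed.

Let first_band_l2 : first_band \in @l2_pred R V.
Proof.
apply/asboolP; apply: le_lt_trans radius_fin.
rewrite /sqnorm /radius_sum [X in (_ <= X)%E]esum_mkcond; apply: le_esum => v _.
rewrite /first_band; case: ifP => h; last first.
  rewrite rnorm0 expr0n /=; case: ifP => // _; by rewrite lee_fin sqr_ge0.
rewrite mem_set; last by apply/level_bandE; rewrite addn1.
by rewrite big_ord1 /= rnorm_real real_normK // num_real.
Qed.

(** The indicator of the levels [0, ..., kT] is square summable (there are only
    finitely many such vertices): it is [S^*] applied to its formal image under [S'],
    whose squared norm is the first radius sum. *)
Lemma top_levels_ex : exists top_levels : l2 R V, forall v, top_levels v = ((depth v <= kT)%N)%:R.
Proof.
exists (adjoint S (L2 first_band_l2)) => u.
rewrite -inner_basis adjointEr.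
have d0 : inner (L2 first_band_l2 - ((depth u <= kT)%N)%:R *: S' (b_ u)) (S (b_ u)) = 0.
  apply: inner_disjoint => v; have [uv|/shift_basis_vanish] := boolP (e u v); last by right.
  left; rewrite l2_subE l2_scaleE dual_nonroot; last exact: nonroot uv.
  rewrite (parE e_tree uv) l2_basisE eqxx mulr1 -[L2 _ v]/(first_band v) /first_band.
  rewrite (depth_edge e_tree root_root uv) !ltnS leq0n andTb.
  by case: (depth u <= kT)%N; rewrite ?mul1r ?mul0r ?subrr ?subr0 //.
have /eqP := d0; rewrite linearBl subr_eq0 => /eqP ->.
by rewrite linearZl_LR /= inner_dual // inner_basis2 eqxx mulr1.
Qed.

Definition top_levels : l2 R V := projT1 (cid top_levels_ex).

Lemma top_levelsE v : top_levels v = ((depth v <= kT)%N)%:R.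
Proof. exact: (projT2 (cid top_levels_ex)). Qed.

Definition top_norm n : R := rnorm (pow_bop S' n top_levels).

Lemma top_norm_ge0 n : 0 <= top_norm n. Proof. exact: rnorm_ge0. Qed.

(** [S'^n] moves the indicator of the levels [0, ..., kT] to the band of levels
    [n, ..., kT + n] and multiplies it there by the weight products. *)
Lemma radius_sumE n : radius_sum e mu root kT n = ((top_norm n ^+ 2)%:E)%E.
Proof.
rewrite /top_norm l2_sqnorm /sqnorm /radius_sum [LHS]esum_mkcond.
apply: eq_esum => v _; case: (boolP (v \in _)) => [|nb].
  rewrite inE => /level_bandE/andP[nv vk].
  rewrite dual_pow_deep // top_levelsE (depth_iter_par e_tree root_root) //.
  by rewrite leq_subLR addnC vk mulr1 rnorm_real real_normK // num_real.
have [nv|nv] := leqP n (depth v); last first.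
  by rewrite dual_pow_shallow // rnorm0 expr0n.
rewrite dual_pow_deep // top_levelsE (depth_iter_par e_tree root_root) // leq_subLR addnC.
case: leqP => [vk|_]; last by rewrite mulr0 rnorm0 expr0n.
by case/negP: nb; rewrite inE; apply/level_bandE; rewrite nv.
Qed.

(** By [ker_deep], [|g| <= |g|_2 top_levels] pointwise, and [S'^n] has nonnegative
    weights. *)
Lemma ker_growth n (g : E) :
  rnorm (pow_bop S' n (ker_val g)) <= top_norm n * rnorm g.
Proof.
rewrite mulrC; apply: rnorm_l2_le; first exact: rnorm_ge0.
move=> v; have [nv|nv] := leqP n (depth v); last first.
  by rewrite !dual_pow_shallow // rnorm0 mulr0.
rewrite !dual_pow_deep // !rnormM mulrCA; apply: ler_wpM2l; first exact: rnorm_ge0.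
rewrite top_levelsE; have [dk|dk] := leqP (depth (iter n par v)) kT.
  by rewrite rnorm_nat mulr1; exact: l2_coord.
by rewrite ker_deep // rnorm0 mulr_ge0 ?rnorm_ge0.
Qed.

Lemma rnorm_top_levels_ge1 : 1 <= rnorm top_levels.
Proof.
apply: le_trans (l2_coord top_levels root).
by rewrite top_levelsE (depth_root e_tree root_root) rnorm_nat.
Qed.

Lemma top_norm_lb : exists2 c : R, 0 < c & forall n, 1 <= top_norm n * c ^+ n.
Proof.
have [c c0 hc] := dual_pow_lb S_linv; exists c => // n.
by apply: le_trans rnorm_top_levels_ge1 _; rewrite mulrC; exact: hc.
Qed.

Lemma top_norm_ub : exists2 M : R, 0 < M & forall n, top_norm n <= rnorm top_levels * M ^+ n.
Proof.
have [M M0 hM] := bop_bound S'; exists M => // n.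
rewrite /top_norm; elim: n => [|n IH]; first by rewrite mulr1.
rewrite pow_bopS exprS mulrCA; apply: le_trans (hM _) _.
by rewrite ler_wpM2l // ltW.
Qed.

(** The equation [(S' - t) x = top_levels] can be solved level by level, and
    [x = - sum_i t^-(i+1) S'^i top_levels] coordinatewise; all the terms have the same
    sign, so each of them is dominated by [x]. *)
Lemma top_norm_resolvent (t : R) : 0 < t -> ~ spectrum S' ((t%:C)%C) ->
  exists C, forall n, top_norm n <= C * t ^+ n.
Proof.
move=> t0; rewrite /spectrum /= => /contrapT[B [_ BK]].
pose x := B top_levels; have xE : S' x - ((t%:C)%C) *: x = top_levels by exact: BK.
pose s : R[i] := ((t^-1)%:C)%C.
have st : s * (t%:C)%C = 1 by rewrite -rmorphM /= mulVf ?gt_eqF.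
have x1 : x = s *: (S' x - top_levels).
  by rewrite -xE opprB addrC subrK scalerA st scale1r.
(* At [v] the remainder vanishes as soon as [n] exceeds the depth of [v]. *)
have expand n : x = - (\sum_(i < n) s ^+ i.+1 *: pow_bop S' i top_levels) + s ^+ n *: pow_bop S' n x.
  elim: n => [|n IH]; first by rewrite big_ord0 oppr0 add0r expr0 scale1r.
  rewrite big_ord_recr opprD -addrA [LHS]IH; congr (_ + _).
  rewrite {1}x1 [pow_bop S' n _]linearZ scalerA -exprSr [pow_bop S' n _]linearB scalerBr.
  by rewrite -pow_bopSr addrC.
exists (t * rnorm x) => m.
have tm : top_norm m <= t ^+ m.+1 * rnorm x.
  apply: rnorm_l2_le; first by rewrite exprn_ge0 ?ltW.
  move=> v.
  have nneg n : exists a : R, [/\ 0 <= a & s ^+ n.+1 * pow_bop S' n top_levels v = (a%:C)%C].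
    have [nv|nv] := leqP n (depth v); last first.
      by exists 0; rewrite dual_pow_shallow // mulr0.
    rewrite dual_pow_deep // top_levelsE.
    exists (t^-1 ^+ n.+1 * (weight_prod n v * ((depth (iter n par v) <= kT)%N)%:R)); split.
      by rewrite mulr_ge0 ?exprn_ge0 ?invr_ge0 ?(ltW t0) // mulr_ge0 // ltW // weight_prod_gt0.
    by rewrite !rmorphM rmorphXn rmorph_nat.
  have [a ha] := choice nneg.
  (* Large enough for the remainder to vanish at [v] and for the term [m] to occur. *)
  pose N := (maxn m (depth v)).+1.
  have xv : x v = - ((\sum_(i < N) a i)%:C)%C.
    rewrite [in LHS](expand N) l2_addE l2_scaleE dual_pow_shallow ?mulr0 ?addr0; last first.
      by rewrite ltnS leq_maxr.
    rewrite -[LHS]inner_basis linearNl linear_sumlz rmorph_sum /=; congr (- _).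
    by apply: eq_bigr => i _; rewrite linearZl_LR /= inner_basis (ha i).2.
  have am : rnorm (pow_bop S' m top_levels v) = t ^+ m.+1 * a m.
    have -> : pow_bop S' m top_levels v = ((t ^+ m.+1 * a m)%:C)%C.
      by rewrite rmorphM rmorphXn /= -(ha m).2 mulrA -exprMn [_ * s]mulrC st expr1n mul1r.
    by rewrite rnorm_real ger0_norm // mulr_ge0 ?exprn_ge0 ?(ltW t0) // (ha m).1.
  rewrite am xv rnormN rnorm_real; apply: ler_wpM2l; first by rewrite exprn_ge0 ?ltW.
  apply: le_trans (ler_norm _).
  have mN : (m < N)%N by rewrite ltnS leq_maxl.
  rewrite (bigD1 (Ordinal mN)) //= lerDl; apply: sumr_ge0 => i _.
  exact: (ha i).1.
by rewrite [t * _]mulrC -mulrA -exprS mulrC.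
Qed.

End TopLevels.

Lemma dual_adjoint_basis v : ~ is_root e v -> L (b_ v) = ((mu v)%:C)%C *: b_ (par v).
Proof.
move=> nr; apply: l2_ext => u; rewrite -inner_basis adjointEr innerC inner_basis.
rewrite dual_nonroot // l2_scaleE !l2_basisE rmorphM /= realC_conj conjC_nat.
by rewrite eq_sym.
Qed.

Lemma pow_dual_adjoint_basis n v : (n <= depth v)%N ->
  exists c, pow_bop L n (b_ v) = c *: b_ (iter n par v).
Proof.
elim: n => [|n IH] nv; first by exists 1; rewrite scale1r.
have [c hc] := IH (ltnW nv); rewrite pow_bopS hc linearZ /= dual_adjoint_basis.
  by exists (c * ((mu (iter n par v))%:C)%C); rewrite scalerA.
apply: (depth_nonroot e_tree root_root).
by rewrite (depth_iter_par e_tree root_root) ?subn_gt0 // ltnW.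
Qed.

Lemma pow_dual_adjoint_basis0 n v : (depth v < n)%N -> pow_bop L n (b_ v) = 0.
Proof.
move=> vn; apply: inner_ext => f; rewrite linear0r -pow_adjointE inner_basis.
exact: dual_pow_shallow.
Qed.

Lemma orth_proj_basis_deep v : (kT < depth v)%N -> P (b_ v) = 0.
Proof.
move=> dv; apply: inner_ext => g; rewrite linear0r innerC orth_projE innerC inner_basis.
by rewrite ker_deep // !conjC0.
Qed.

Lemma model_coef_basis0 n v : (depth v < n)%N || (n + kT < depth v)%N -> model_coef S (b_ v) n = 0.
Proof.
rewrite /model_coef; have [vn _|nv /= h] := ltnP (depth v) n.
  by rewrite pow_dual_adjoint_basis0 // linear0.
have [c ->] := pow_dual_adjoint_basis nv.
rewrite linearZ /= orth_proj_basis_deep ?scaler0 //.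
by rewrite (depth_iter_par e_tree root_root) // ltn_subRL.
Qed.

Lemma dual_pow_ker_supp k (g : E) v : pow_bop S' k (ker_val g) v != 0 ->
  (k <= depth v <= k + kT)%N.
Proof.
have [kv|kv] := leqP k (depth v); last by rewrite dual_pow_shallow // eqxx.
rewrite dual_pow_deep //=; have [//|dv] := leqP (depth v) (k + kT).
rewrite ker_deep ?mulr0 ?eqxx //.
by rewrite (depth_iter_par e_tree root_root) // ltn_subRL.
Qed.

Lemma model_coef_band j k (g : E) : ~~ ((j <= k + kT) && (k <= j + kT))%N ->
  P (pow_bop L j (pow_bop S' k (ker_val g))) = 0.
Proof.
move=> jk; apply: inner_ext => h; rewrite linear0r innerC orth_projE.
rewrite innerC -pow_adjointE inner_disjoint ?conjC0 // => v.
have [->|/dual_pow_ker_supp/andP[jv vj]] := eqVneq (pow_bop S' j (ker_val h) v) 0; first by left.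
have [->|/dual_pow_ker_supp/andP[kv vk]] := eqVneq (pow_bop S' k (ker_val g) v) 0; first by right.
by case/negP: jk; rewrite (leq_trans jv vk) (leq_trans kv vj).
Qed.

(** Such an [f] is in the range of every [S^N], hence vanishes on every level. *)
Lemma model_coef_separates f : (forall n, model_coef S f n = 0) -> f = 0.
Proof.
move=> f0; apply: l2_ext => v.
rewrite (wold_expansion S_linv (depth v).+1 f) big1 ?add0r.
  exact: pow_shift_shallow.
by move=> n _; rewrite -/(model_coef S f n) f0 linear0.
Qed.

(** [L] moves each basis vector one level towards the root and kills the one at the
    root, so a power of [L] annihilates a finitely supported function. *)
Lemma wold_finite (s : seq V) (a : V -> R[i]) : exists N,
  let h := \sum_(v <- s) a v *: b_ v in
  h = \sum_(n < N) pow_bop S n (ker_val (model_coef S h n)).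
Proof.
pose N := (\max_(v <- s) (depth v)).+1; exists N => h.
rewrite {1}[h](wold_expansion S_linv N) (_ : pow_bop L N h = 0) ?linear0 ?addr0 //.
rewrite /h linear_sum big_seq big1 // => v vs.
rewrite (_ : pow_bop L N (a v *: b_ v) = a v *: pow_bop L N (b_ v)); last by rewrite linearZ.
rewrite pow_dual_adjoint_basis0 ?scaler0 //.
by rewrite /N ltnS; exact: (@leq_bigmax_seq _ _ xpredT).
Qed.

Lemma wold_basis v :
  b_ v = \sum_(n < (depth v).+1) pow_bop S n (ker_val (model_coef S (b_ v) n)).
Proof.
rewrite {1}[b_ v](wold_expansion S_linv (depth v).+1).
by rewrite pow_dual_adjoint_basis0 ?linear0 ?addr0.
Qed.

End WeightedShift.

(** * The model on the disc of convergence *)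
Lemma closure_rnorm (R : realType) (V : normedModType R[i]) (A : set V) x :
  (forall eps : R, 0 < eps -> exists2 y, A y & rnorm (x - y) < eps) -> closure A x.
Proof.
move=> h B /nbhs_ballP[eps /= eps0 hB].
have eE : eps = ((rnorm eps)%:C)%C by rewrite rnormC gtr0_norm.
have [|y Ay xy] := h (rnorm eps); first by rewrite -ltcR -eE.
by exists y; split => //; apply: hB; rewrite -ball_normE /= eE -rnormC ltcR.
Qed.

Theorem theorem2p7 (R : realType) (V : countType) (e : rel V) (root : V)
    (kT : nat) (lam : V -> R) (S : bop (l2 R V) (l2 R V))
    (V_infinite : infinite_set [set: V])
    (e_tree : directed_tree e) (e_leafless : leafless e)
    (root_root : is_root e root)
    (kT_index : branching_index e R root = (kT%:R : R)%:E)
    (S_shift : is_weighted_shift e lam S)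
    (S_left_invertible : left_invertible S)
    (radius_sum_finite : forall n, (0 < n)%N ->
       (radius_sum e (dual_weight e lam S) root kT n < +oo)%E) :
  let S' := cauchy_dual S in
  let E := ker (adjoint S) in
  let P_E := orth_proj (adjoint S) in
  let C (j k : nat) : bop E E :=
    comp_bop P_E (comp_bop (pow_bop (adjoint S') j)
      (comp_bop (pow_bop S' k) (ker_incl (adjoint S)))) in
  let r := convergence_radius e (dual_weight e lam S) root kT in
  let D := disc r in
  (exists (H : rkhs D E) (U : {linear l2 R V -> H}),
    [/\ [/\ holomorphic H, z_invariant H, unitary U &
            forall f, mult_z (U f) = U (S f)],
        (forall g : E, represents (U (ker_val g)) (fun=> g)) /\
          [set U (ker_val g) | g in [set: E]] = constants H,
        exists kappa : R[i] -> R[i] -> bop E E,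
          (forall w (g : E), D w -> exists h : H,
             represents h (fun z => kappa z w g) /\
             forall f, inner (U f) h = inner (rk_eval H w (U f)) g) /\
          (forall z w, D z -> D w ->
             opnorm_sum (band kT)
               (fun jk g => (z ^+ jk.1 * (w^*) ^+ jk.2) *: C jk.1 jk.2 g)
               (fun g => kappa z w g - g)),
        [/\ forall a : seq E, exists h : H, represents h (polyfun a),
            dense [set h : H | exists a : seq E, represents h (polyfun a)] &
            closed_span [set h : H | exists n (f : H), constants H f /\
              represents h (fun z => z ^+ n *: rk_eval H z f)] = [set: H]] &
        exists B : set H, orthonormal_basis B /\
          forall b, B b -> exists a : seq E,
            represents b (polyfun a) /\
            (count (fun c => c != 0%R) a <= kT + 1)%N]) /\
  (1 <= r * spectral_radius S')%E.
Proof.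
move=> S' E P_E C r D.
have linv := S_left_invertible.
have rfin := radius_sum_finite 1%N isT.
pose a := top_norm e_tree root_root S_shift linv rfin.
have a0 n : 0 <= a n := top_norm_ge0 e_tree root_root S_shift linv rfin n.
have rE : r = root_liminf a.
  rewrite /r /convergence_radius /root_liminf /root_term; congr limn_einf.
  by apply/funext => n; rewrite (radius_sumE e_tree root_root S_shift linv rfin).
have [M M0 aM] := top_norm_ub e_tree root_root S_shift linv rfin.
have r_ge : (M^-1%:E <= r)%E by rewrite rE; exact: root_liminf_ge a0 M0 aM.
have [c c0 ac] := top_norm_lb e_tree root_root S_shift linv rfin.
have r_le : (r <= c%:E)%E by rewrite rE; exact: root_liminf_le a0 c0 ac.
have Mi0 : 0 < M^-1 by rewrite invr_gt0.
have D_summable z : D z -> summable_at S z.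
  rewrite /D /disc /= => zr.
  have rr : r = (fine r)%:E.
    by case: (r) r_ge r_le => [x| |] //=; rewrite ?leNgt ?ltNyr ?ltry.
  rewrite rr lte_fin in zr; pose t := (rnorm z + fine r) / 2.
  have zt : rnorm z < t by rewrite /t; have := rnorm_ge0 z; lra.
  have t0 : 0 < t := le_lt_trans (rnorm_ge0 z) zt.
  have tr : (t%:E < root_liminf a)%E by rewrite -rE rr lte_fin /t; lra.
  have [K K0 hK] := root_liminf_gt a0 t0 tr.
  exists K, t^-1; split; last by rewrite ltr_pdivrMl // mulr1.
  split => //; first by rewrite invr_ge0 ltW.
  move=> n g; apply: le_trans (ker_growth e_tree root_root kT_index S_shift linv rfin n g) _.
  by apply: ler_wpM2r; [exact: rnorm_ge0|exact: hK].
have D_small z : rnorm z < M^-1 -> D z.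
  by move=> zM; rewrite /D /disc /=; apply: lt_le_trans r_ge; rewrite lte_fin.
pose F := @model_eval R _ S.
have F_ext (h1 h2 : l2 R V) : (forall z, D z -> F z h1 = F z h2) -> h1 = h2.
  move=> h12; apply/eqP; rewrite -subr_eq0; apply/eqP.
  have [|K [p [gr _]]] := D_summable 0; first by apply: D_small; rewrite rnorm0.
  apply: (model_coef_separates e_tree root_root S_shift linv).
  apply: (model_eval_coef0 gr Mi0) => w _ wM.
  by rewrite linearB; apply/eqP; rewrite subr_eq0; apply/eqP/h12/D_small.
(* [l^2(V)] itself, its elements being read as functions through [F]. *)
pose H : rkhs D E := @Rkhs R D E (l2 R V) F F_ext.
pose poly_vec (s : seq E) : l2 R V :=
  \sum_(i < size s) pow_bop S i (ker_val s`_i).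
have poly_rep s : @represents R D E H (poly_vec s) (polyfun s).
  move=> z Dz; rewrite /= /poly_vec linear_sum /polyfun; apply: eq_bigr => i _.
  by rewrite /F model_eval_pow ?model_eval_ker //; exact: D_summable.
have poly_mk N (g : nat -> E) :
    poly_vec (mkseq g N) = \sum_(i < N) pow_bop S i (ker_val (g i)).
  rewrite /poly_vec size_mkseq; apply: eq_bigr => i _.
  by rewrite nth_mkseq.
have const_rep (g : E) : @represents R D E H (ker_val g) (fun=> g).
  by move=> z Dz; rewrite /= /F model_eval_ker //; exact: D_summable.
have monom_rep n (g : E) : @represents R D E H (pow_bop S n (ker_val g))
    (fun z => z ^+ n *: rk_eval H z (ker_val g)).
  by move=> z Dz; rewrite /= /F model_eval_pow //; exact: D_summable.
have mult_rep f : @represents R D E H (S f) (fun z => z *: rk_eval H z f).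
  by move=> z Dz; rewrite /= /F model_eval_op //; exact: D_summable.
split; last first.
  (* Otherwise some [t] is larger than the spectral radius and smaller than [1/r];
     it is not in the spectrum, so that [r >= 1/t]. *)
  rewrite leNgt; apply/negP => lt1.
  have rr : r = (fine r)%:E.
    by case: (r) r_ge r_le => [x| |] //=; rewrite ?leNgt ?ltNyr ?ltry.
  have r0 : 0 < fine r by apply: lt_le_trans Mi0 _; rewrite -lee_fin -rr.
  have [t [t0 tr rho_t]] : exists t, [/\ 0 < t, t < (fine r)^-1 & (spectral_radius S' < t%:E)%E].
    have ri0 : 0 < (fine r)^-1 by rewrite invr_gt0.
    move: lt1; rewrite rr; case: (spectral_radius S') => [x| |].
    - rewrite -EFinM lte_fin => xr; have {}xr : x < (fine r)^-1.
        by rewrite -[_^-1]mulr1 ltr_pdivlMl.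
      exists ((Num.max x 0 + (fine r)^-1) / 2).
      have m1 : Num.max x 0 < (fine r)^-1 by rewrite gt_max xr.
      have m2 : x <= Num.max x 0 by rewrite le_max lexx.
      have m3 : 0 <= Num.max x 0 by rewrite le_max lexx orbT.
      by split; rewrite ?lte_fin; lra.
    - by rewrite gt0_muley ?lte_fin // ltNge leey.
    - by move=> _; exists ((fine r)^-1 / 2); split; rewrite ?ltNyr //; lra.
  have [|K hK] := top_norm_resolvent e_tree root_root S_shift linv rfin t0.
    move=> sp; have : (t%:E <= spectral_radius S')%E.
      apply: ereal_sup_ubound; exists ((t%:C)%C) => //.
      by rewrite rnorm_real gtr0_norm.
    by rewrite leNgt rho_t.
  have := root_liminf_ge a0 t0 hK; rewrite -rE rr lee_fin leNgt => /negP; apply.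
  by rewrite -[fine r]invrK ltf_pV2 // posrE invr_gt0.
exists H, (idfun : {linear l2 R V -> l2 R V}); split.
- split.
  + by move=> h z Dz; apply: model_eval_derivable => //; exact: D_summable.
  + by move=> h; exists (S h); exact: mult_rep.
  + by split => // y; exists y.
  + move=> f /=; apply: (@xget_unique _ (0 : H)); first exact: mult_rep.
    by move=> y hy; apply: (F_ext) => z Dz; rewrite [LHS]hy // [RHS]mult_rep.
- split => //; rewrite predeqE => h; split => [[g _ <-]|[g hg]]; first by exists g; exact: const_rep.
  by exists g => //; apply: (F_ext) => z Dz; rewrite [LHS]const_rep // [RHS]hg.
- exists (fun z w => comp_bop (F z) (adjoint (F w))); split.
    move=> w g Dw; exists (adjoint (F w) g); split => // f.
    by rewrite /= -adjointE.
  move=> z w Dz Dw.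
  have [K [p [gr pz]]] := D_summable _ Dz.
  have [K' [p' [gr' pw]]] := D_summable _ Dw.
  have hb j k (g : ker (adjoint S)) :=
    @model_coef_band _ _ _ _ _ _ _ e_tree root_root kT_index S_shift linv j k g.
  exact: (@kernel_opnorm_sum R _ S z w K p K' p' gr pz gr' pw kT hb).
- split.
  + by move=> s; exists (poly_vec s); exact: poly_rep.
  + move=> O [x Ox] oO.
    have : closure [set h : H | exists a : seq E, represents h (polyfun a)] x.
      apply: closure_rnorm => eps eps0; have [s hs] := finite_support_dense x eps0.
      have [N hN] := wold_finite e_tree root_root S_shift linv s x.
      eexists; last exact: hs; rewrite hN.
      by eexists; rewrite -poly_mk; exact: poly_rep.
    move=> /(_ O); have Onb : nbhs x O by exact: open_nbhs_nbhs.
    by move=> /(_ Onb)[y [? ?]]; exists y.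
  + rewrite -subTset => x _; apply: closure_rnorm => eps eps0.
    have [s hs] := finite_support_dense x eps0.
    have [N hN] := wold_finite e_tree root_root S_shift linv s x.
    eexists; last exact: hs; rewrite hN.
    exists N, (fun=> 1); eexists; split; last first.
      by apply: eq_bigr => i _; rewrite scale1r.
    move=> i /=; eexists; eexists; split; last exact: monom_rep.
    by eexists; exact: const_rep.
- exists (range (@l2_basis R V)); split.
    split.
      move=> _ _ [u _ <-] [v _ <-]; rewrite inner_basis2.
      congr (_%:R); congr nat_of_bool; apply/eqP/eqP => [->//|uv].
      apply/eqP; have := congr1 (fun f : l2 R V => f u) uv; rewrite !l2_basisE eqxx.
      by case: eqP => // _ /eqP; rewrite oner_eq0.
    rewrite -subTset => x _; apply: closure_rnorm => eps eps0.
    have [s hs] := finite_support_dense x eps0.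
    eexists; last exact: hs.
    exists (size s), (fun i => x (tnth (in_tuple s) i)),
      (fun i => @l2_basis R V (tnth (in_tuple s) i)); split.
      by move=> i; exists (tnth (in_tuple s) i).
    by rewrite [LHS]big_tnth.
  move=> _ [v _ <-]; set s := mkseq (model_coef S (@l2_basis R V v)) (depth e root v).+1.
  exists s; split.
    have sE : @l2_basis R V v = poly_vec s.
      by rewrite poly_mk; exact: wold_basis e_tree root_root S_shift linv v.
    by rewrite sE; exact: poly_rep.
  (* The nonzero coefficients have index between [d - kT] and [d]. *)
  rewrite count_map; set d := depth e root v.
  apply: leq_trans (_ : count (fun n => d <= n + kT)%N (iota 0 d.+1) <= _)%N.
    apply: sub_count => n /=; apply: contraR; rewrite -ltnNge => nd.
    by rewrite (model_coef_basis0 e_tree root_root kT_index S_shift linv) // nd orbT.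
  rewrite addn1; have [dk|kd] := leqP d kT.
    by apply: leq_trans (count_size _ _) _; rewrite size_iota.
  have -> : d.+1 = ((d - kT) + kT.+1)%N by rewrite addnS subnK // ltnW.
  rewrite iotaD count_cat (_ : count _ (iota 0 _) = 0)%N ?add0n; last first.
    apply/eqP; rewrite -leqn0 leqNgt -has_count; apply/hasPn => n.
    by rewrite mem_iota add0n /= -ltnNge ltn_subRL addnC.
  by apply: leq_trans (count_size _ _) _; rewrite size_iota.
Qed.
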